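(* Let $n\ge3$, $\ell\ge2$, and let $\lambda=[d_1,\ldots,d_r]$ be a partition of $d$ with $r\ge2$ parts. If $2\ell=n+1$, then $\dim\sigma_\ell(\mathbb X_{n-1,\lambda})\le D(\ell,n,\lambda)$, where $D(\ell,n,\lambda)$ is the predicted dimension defined in the context.
   Context: Let $\mathbb K$ be an algebraically closed field of characteristic zero and $S=\mathbb K[x_1,\ldots,x_n]=\bigoplus_{i\ge0}[S]_i$ the standard graded polynomial ring. A partition $\lambda=[d_1,\ldots,d_r]$ of $d$ consists of integers $d_1\ge\cdots\ge d_r\ge1$ with sum $d$; put $s=d_2+\cdots+d_r$ and $N=\binom{d+n-1}{n-1}$. Let $$\mathbb X_{n-1,\lambda}=\{[F]\in\mathbb P([S]_d)=\mathbb P^{N-1}\mid F=F_1\cdots F_r,\ 0\ne F_i\in[S]_{d_i}\},$$ which has dimension $\sum_{i=1}^r\binom{d_i+n-1}{n-1}-r$. $\sigma_\ell(\mathbb X_{n-1,\lambda})$ is the Zariski closure in $\mathbb P^{N-1}$ of the union of the linear spans of all subsets of $\ell$ distinct points of $\mathbb X_{n-1,\lambda}$ (and is $\mathbb P^{N-1}$ for $\ell\ge N$). Convention: $\binom ab=0$ if $a<0$. For $0\le j\le d$ define $$a_j(\ell,n,\lambda)=\binom{j+n-1}{n-1}-\ell\sum_{i=1}^r\binom{j+d_i-d+n-1}{n-1}+(r-1)\ell\binom jd+\sum_{k=2}^\ell(-1)^k\binom\ell k\binom{j-k(d-d_1)+n-1}{n-1}$$ $$\qquad+\binom\ell2\binom{j+2d_2-2d+n-1}{n-1}+\ell(\ell-1)\binom{j+d_1+d_2-2d+n-1}{n-1}.$$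 Predicted dimension $D(\ell,n,\lambda)$: if there is an integer $j$ with $s\le j\le d$ and $a_j(\ell,n,\lambda)\le0$, then $D(\ell,n,\lambda)=N-1$. Otherwise $$D(\ell,n,\lambda)=\ell\cdot\dim\mathbb X_{n-1,\lambda}+\ell-1-\sum_{k=2}^{\ell}(-1)^k\binom{\ell}{k}\binom{d_1-(k-1)s+n-1}{n-1}-\binom{\ell}{2}\binom{2d_2-d+n-1}{n-1}-\ell(\ell-1)\binom{d_1+d_2-d+n-1}{n-1}.$$ *)

(* Defs.v *)
From HB Require Import structures.
From mathcomp Require Import all_boot all_order all_algebra.
From mathcomp Require Import classical_sets.
From mathcomp Require Import mpoly.

Set Implicit Arguments.
Unset Strict Implicit.
Unset Printing Implicit Defensive.

Import GRing.Theory Num.Theory.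
Local Open Scope classical_set_scope.
Local Open Scope ring_scope.

(* P(V): a point is a line through the origin of V. *)
Definition proj (K : fieldType) (V : vectType K) : Type :=
  {U : {vspace V} | \dim U == 1%N}.

Definition line (K : fieldType) (V : vectType K) (P : proj V) : {vspace V} :=
  sval P.

Section Projective.
Context {K : fieldType} {V : vectType K}.
Implicit Types (Z A B : set (proj V)) (P : proj V).

(* Homogeneous coordinates are taken in the basis [vbasis fullv]; a polynomial
   vanishes at a point when it vanishes on every vector of the line. *)
Definition zero_locus (I : set {mpoly K[\dim {:V}]}) : set (proj V) :=
  [set P : proj V | forall f v, I f -> v \in line P ->
     f.@[fun i => coord (vbasis {:V}) i v] = 0].

Definition zariski_closed Z : Prop :=
  exists2 I : set {mpoly K[\dim {:V}]},
    (forall f, I f -> f \is homog mdeg) & Z = zero_locus I.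

Definition zariski_closure A : set (proj V) :=
  \bigcap_(Z in [set Z | zariski_closed Z /\ A `<=` Z]) Z.

Definition irreducible_closed Z : Prop :=
  [/\ zariski_closed Z, Z !=set0 &
      forall A B, zariski_closed A -> zariski_closed B ->
        Z `<=` A `|` B -> Z `<=` A \/ Z `<=` B].

Definition has_irreducible_chain Z (m : nat) : Prop :=
  exists C : nat -> set (proj V),
    (forall i, (i <= m)%N -> irreducible_closed (C i) /\ C i `<=` Z) /\
    (forall i, (i < m)%N -> C i `<` C i.+1).

(* Krull dimension, intended for a nonempty closed [Z]. *)
Definition is_proj_dim Z (m : nat) : Prop :=
  has_irreducible_chain Z m /\
  forall k, has_irreducible_chain Z k -> (k <= m)%N.

Definition secant_variety (l : nat) (X : set (proj V)) : set (proj V) :=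
  if (\dim {:V} <= l)%N then setT else
  zariski_closure [set P : proj V | exists p : 'I_l -> proj V,
    [/\ injective p, forall i, X (p i) &
        (line P <= \sum_(i < l) line (p i))%VS]].

End Projective.

(* [S]_d for S = K[x_1, ..., x_n].  The number of variables is written n.-1.+1
   (equal to n for n > 0) because the vector space structure on [dhomog] is
   only available in that form. *)
Notation form K n d := (dhomog n.-1.+1 K d).

Definition is_partition_of (d : nat) (la : seq nat) : bool :=
  [&& sorted geq la, 0%N \notin la & sumn la == d].

Definition reducible_forms (K : fieldType) (n d : nat) (la : seq nat) :
    set (proj (form K n d)) :=
  [set P | exists (F : form K n d)
                  (Fi : forall i : 'I_(size la), form K n (nth 0%N la i)),
    [/\ forall i, Fi i != 0,
        mpoly_of_dhomog F = \prod_(i < size la) mpoly_of_dhomog (Fi i) &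
        line P = <[F]>%VS]].

Arguments reducible_forms K n d la : clear implicits.

(* The convention binom(a, b) = 0 for a < 0. *)
Definition binz (a : int) (b : nat) : int :=
  if a is Posz m then 'C(m, b)%:Z else 0.

Section Prediction.
Variables (l n : nat) (la : seq nat).
Let r := size la.
Let d := sumn la.
Let d1 := nth 0%N la 0.
Let d2 := nth 0%N la 1.
Let s := sumn (behead la).

(* binom(t + n - 1, n - 1) *)
Let h (t : int) : int := binz (t + n%:Z - 1) n.-1.

Definition ambient_N : int := h d%:Z.

(* The dimension of X_{n-1,lambda}. *)
Definition dim_reducible_forms : int := \sum_(di <- la) h di%:Z - r%:Z.

Definition a_coef (j : nat) : int :=
    h j%:Z
  - l%:Z * \sum_(di <- la) h (j%:Z + di%:Z - d%:Z)
  + (r%:Z - 1) * l%:Z * 'C(j, d)%:Z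
  + \sum_(2 <= k < l.+1)
      (-1) ^+ k * 'C(l, k)%:Z * h (j%:Z - k%:Z * (d%:Z - d1%:Z))
  + 'C(l, 2)%:Z * h (j%:Z + 2 * d2%:Z - 2 * d%:Z)
  + l%:Z * (l%:Z - 1) * h (j%:Z + d1%:Z + d2%:Z - 2 * d%:Z).

Definition predicted_dim : int :=
  if [exists j : 'I_d.+1, (s <= j)%N && (a_coef j <= 0)]
  then ambient_N - 1
  else l%:Z * dim_reducible_forms + l%:Z - 1
     - \sum_(2 <= k < l.+1)
         (-1) ^+ k * 'C(l, k)%:Z * h (d1%:Z - (k%:Z - 1) * s%:Z)
     - 'C(l, 2)%:Z * h (2 * d2%:Z - d%:Z)
     - l%:Z * (l%:Z - 1) * h (d1%:Z + d2%:Z - d%:Z).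

End Prediction.

(* Main.v *)
Require Import Defs.
From HB Require Import structures.
From mathcomp Require Import all_boot all_order all_algebra.
From mathcomp Require Import boolp classical_sets.
From mathcomp Require Import mpoly.
From mathcomp Require Import ring zify.

Set Implicit Arguments.
Unset Strict Implicit.
Unset Printing Implicit Defensive.

Import GRing.Theory Num.Theory.
Local Open Scope ring_scope.

(** Let [S] be the polynomial ring of the theorem, in [2l - 1] variables. If
    [a_j <= 0] for some [s <= j <= d] the predicted dimension is [N - 1], and
    otherwise its formula is [N - 1 - a_d]. The dimension is the length of a
    longest chain of irreducible closed subsets, so it exists and is bounded
    as required once every chain has length less than [N] and at most [N - 1 -
    a_d].

    Chains and tangent spaces. A chain of length [k] in a projective variety
    gives [k + 1] polynomials that are algebraically independent modulo its
    ideal ([chain_independent]). The affine cone over the secant variety is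
    the closure of the image of the map sending the coefficients of [l] tuples
    of forms [F_ij] of degree [d_j] to [\sum_i \prod_j F_ij]; pulling back
    along this map preserves independence. In characteristic zero,
    algebraically independent polynomials have independent differentials
    somewhere ([algebraically_independent_jacobian]), so that [k + 1] is at
    most the dimension of the image of the differential of the map at some
    point, the tangent space ([secant_chain_leq]). It is the degree [d] part
    of the ideal [J_1 + ... + J_l] of [S], where [J_i] is generated by the
    products [\prod_(j' != j) F_ij'].

    Semicontinuity in the right direction. Evaluating this dimension on
    special forms would bound it from below only. Instead the tuples are
    lifted to the ring [T] with one more variable. The kernel of the
    restriction [T -> S] contains the new variable times [J_1 + ... + J_l] in
    degree [d - 1], so the dimension over [S] is at most the difference of the
    dimensions of [J_1 + ... + J_l] over [T] in degrees [d] and [d - 1]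
    ([dim_ideal_part_mres]). Moreover, with [Q_k = J_1 + ... + J_(k-1)], the
    intersection of [Q_k] and [J_k] contains [Q_k J_k], and [dim (J_k)_d <=
    \sum_j dim T_(d_j) - (r - 1)]. Therefore the dimension of [(J_1 + ... +
    J_l)_d] over [T] is at most [l (\sum_j dim T_(d_j) - (r - 1)) - \sum_k dim
    (Q_k J_k)_d] ([dim_sum_gens]). Now all dimensions that depend on the forms
    enter with a minus sign and are lower semicontinuous, so they may be
    replaced by their values on any one tuple of forms over [T]
    ([dim_tangent_leq]).

    The special tuple. As [2l] is the number of variables of [T], these can be
    split into [l] pairs [x_i, y_i], and one takes [F_ij = (x_i - j y_i)^d_j].
    In two variables the ideal of the cofactors has in each degree [m <= d] a
    number of leading monomials that is at least an explicit [lead_count m]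
    ([card_lead_degrees], [lead_degrees_top]). Leading monomials are
    multiplicative, so for products of binary forms in the different pairs the
    dimensions above are bounded below by the numbers of monomials of [T] with
    one leading binary part, or with two of them ([exists_special_counts]).

    Counting. The generating function of [lead_count] is congruent to [P(t) /
    (1 - t)^2] modulo [t^(d+1)], where [P = \sum_j t^(d - d_j) - (r - 1) t^d]
    ([eps_poly_cong]). Counting instead the monomials of [T] without a leading
    part, the bound for the tangent space becomes [N] minus the coefficient of
    [t^d] in [(1 - P)^l / (1 - t)^(2l - 1)] ([count_none_diff]). In the powers
    [P^k] with [k >= 2] only [t^(k (d - d_1))] and, for [k = 2], multiples of
    [t^d] coming from [d_1 + d_2 = d] or [2 d_2 = d] survive, and the
    coefficient turns out to be [a_d] ([a_coefE]). *)

(** * Substitution and restriction to hyperplanes *)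

Lemma mpoly_ring_ind n (R : nzRingType) (P : {mpoly R[n]} -> Prop) :
  (forall c, P c%:MP) -> (forall i, P 'X_i) ->
  (forall p q, P p -> P q -> P (p + q)) ->
  (forall p q, P p -> P q -> P (p * q)) -> forall p, P p.
Proof.
move=> PC PX PD PM; elim/mpolyind => [|c m p _ _ Pp]; first by rewrite -mpolyC0.
apply: PD => //; rewrite -mul_mpolyC mpolyXE_id; apply: (PM) => //.
apply: (big_ind P) => [|p1 p2|i _]; [by rewrite -mpolyC1|exact: PM|].
by elim: (m i) => [|e IHe]; rewrite ?expr0 -?mpolyC1 // exprS; apply: PM.
Qed.

Section Substitution.
Context {R : comNzRingType}.

(** A constant with canonical ring morphism structure, so that the [rmorph]
    lemmas apply to substitutions of polynomials. *)
Definition msubst n k (h : 'I_n -> {mpoly R[k]}) (p : {mpoly R[n]}) :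
  {mpoly R[k]} := mmap (@mpolyC k R) h p.

HB.instance Definition _ n k (h : 'I_n -> {mpoly R[k]}) :=
  GRing.RMorphism.copy (msubst h) (mmap (@mpolyC k R) h).

Lemma msubstC n k (h : 'I_n -> {mpoly R[k]}) c : msubst h c%:MP = c%:MP.
Proof. exact: mmapC. Qed.

Lemma msubstX n k (h : 'I_n -> {mpoly R[k]}) i : msubst h 'X_i = h i.
Proof. by rewrite /msubst mmapX mmap1U. Qed.

Lemma msubstZ n k (h : 'I_n -> {mpoly R[k]}) c p :
  msubst h (c *: p) = c *: msubst h p.
Proof. by rewrite -!mul_mpolyC rmorphM /= msubstC. Qed.

Lemma meval_msubst n k (h : 'I_n -> {mpoly R[k]}) p v :
  (msubst h p).@[v] = p.@[fun i => (h i).@[v]].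
Proof.
elim/mpoly_ring_ind: p => [c|i|p q|p q]; first by rewrite msubstC !mevalC.
- by rewrite msubstX mevalXU.
- by move=> IHp IHq; rewrite rmorphD !mevalD IHp IHq.
- by move=> IHp IHq; rewrite rmorphM !mevalM IHp IHq.
Qed.

Lemma msubst_comp n k m (g : 'I_k -> {mpoly R[m]}) (h : 'I_n -> {mpoly R[k]}) p :
  msubst g (msubst h p) = msubst (fun i => msubst g (h i)) p.
Proof.
elim/mpoly_ring_ind: p => [c|i|p q|p q]; first by rewrite !msubstC.
- by rewrite !msubstX.
- by move=> IHp IHq; rewrite !rmorphD /= IHp IHq.
- by move=> IHp IHq; rewrite !rmorphM /= IHp IHq.
Qed.

Lemma mderivXU n (i j : 'I_n) : ('X_j : {mpoly R[n]})^`M(i) = (j == i)%:R.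
Proof.
rewrite mderivX mnm1E; case: eqP => [->|_]; last by rewrite scale0r.
by rewrite -{1}[U_(i)%MM]add0m addmK mpolyX0 scale1r.
Qed.

Lemma mderiv_msubst n k (h : 'I_n -> {mpoly R[k]}) p i :
  (msubst h p)^`M(i) = \sum_j msubst h (p^`M(j)) * (h j)^`M(i).
Proof.
elim/mpoly_ring_ind: p => [c|l|p q|p q].
- rewrite msubstC mderivC big1 // => j _.
  by rewrite mderivC rmorph0 mul0r.
- rewrite msubstX (bigD1 l) //= mderivXU eqxx rmorph1 mul1r big1 ?addr0 //.
  by move=> j /negPf nj; rewrite mderivXU eq_sym nj rmorph0 mul0r.
- move=> IHp IHq; rewrite rmorphD !mderivD IHp IHq -big_split.
  by apply: eq_bigr => j _ /=; rewrite mderivD rmorphD mulrDl.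
- move=> IHp IHq; rewrite rmorphM !mderivM IHp IHq mulr_suml mulr_sumr.
  rewrite -big_split; apply: eq_bigr => j _ /=.
  by rewrite mderivM rmorphD !rmorphM /=; ring.
Qed.

(** Restriction to the hyperplane [x_j = c], the remaining variables being
    renumbered. *)
Definition mfix n (j : 'I_n.+1) (c : R) : {mpoly R[n.+1]} -> {mpoly R[n]} :=
  msubst (fun i => if unlift j i is Some i' then 'X_i' else c%:MP).

HB.instance Definition _ n (j : 'I_n.+1) c :=
  GRing.RMorphism.copy (mfix j c) (msubst _).

Lemma mfix_mderiv n (j : 'I_n.+1) c p q :
  (mfix j c p)^`M(q) = mfix j c (p^`M(lift j q)).
Proof.
rewrite mderiv_msubst (bigD1 (lift j q)) //= liftK mderivXU eqxx mulr1.
rewrite big1 ?addr0 // => i; case: unliftP => [i' ->|_ _].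
  rewrite (inj_eq lift_inj) => /negPf ni.
  by rewrite mderivXU ni mulr0.
by rewrite mderivC mulr0.
Qed.

Lemma mfix_eq0 n (j : 'I_n.+1) c p :
  mfix j c p = 0 -> exists q, p = ('X_j - c%:MP) * q.
Proof.
pose up : {mpoly R[n]} -> {mpoly R[n.+1]} :=
  msubst (fun i => 'X_(lift j i)).
suff [q] : exists q, p = up (mfix j c p) + ('X_j - c%:MP) * q.
  by move=> Ep p0; exists q; rewrite {1}Ep p0 /up rmorph0 add0r.
elim/mpoly_ring_ind: p => [a|i|p q|p q].
- by exists 0; rewrite /up /mfix !msubstC mulr0 addr0.
- rewrite /up /mfix msubstX; case: unliftP => [i' ->|->].
    by exists 0; rewrite msubstX mulr0 addr0.
  by exists 1; rewrite msubstC mulr1 addrC subrK.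
- move=> [p' Ep] [q' Eq]; exists (p' + q').
  by rewrite {1}Ep {1}Eq /up !rmorphD /=; ring.
- move=> [p' Ep] [q' Eq].
  exists (p' * q + up (mfix j c p) * q').
  rewrite {1}Ep {1}Eq /up !rmorphM /= -/(up _) -/(up _).
  by rewrite [q in p' * q]Eq; ring.
Qed.

Definition vfix n (j : 'I_n.+1) (c : R) (v : 'I_n -> R) (i : 'I_n.+1) : R :=
  if unlift j i is Some i' then v i' else c.

Lemma meval_mfix n (j : 'I_n.+1) c p v : (mfix j c p).@[v] = p.@[vfix j c v].
Proof.
rewrite meval_msubst; apply: meval_eq => i; rewrite /vfix.
by case: unlift => [i'|]; rewrite ?mevalXU ?mevalC.
Qed.

End Substitution.

Lemma msize_mulXsubC (K : idomainType) n (j : 'I_n) c (p : {mpoly K[n]}) :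
  p != 0 -> msize (('X_j - c%:MP) * p) = (msize p).+1.
Proof.
have mX : msize ('X_j - c%:MP : {mpoly K[n]}) = 2%N.
  have X0 : ('X_j - c%:MP : {mpoly K[n]})@_U_(j) = 1.
    by rewrite mcoeffB mcoeffX mcoeffC eqxx mnm1_eq0 mulr0 subr0.
  apply/eqP; rewrite eqn_leq; apply/andP; split.
    apply: leq_trans (msizeD_le _ _) _; rewrite msizeN msizeC msizeX mdeg1.
    by case: (c != 0).
  have /msize_mdeg_lt: U_(j)%MM \in msupp ('X_j - c%:MP : {mpoly K[n]}).
    by rewrite mcoeff_msupp X0 oner_neq0.
  by rewrite mdeg1.
by move=> p0; rewrite msizeM // ?mX // -msize_poly_eq0 mX.
Qed.

(** By degree: a polynomial vanishing on the hyperplane [x_j = c] is divisible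
    by [x_j - c]. *)
Lemma mfix_all_eq0 (K : idomainType) n (j : 'I_n.+1) (s : seq K)
    (p : {mpoly K[n.+1]}) :
  uniq s -> (msize p <= size s)%N -> (forall c, c \in s -> mfix j c p = 0) ->
  p = 0.
Proof.
elim: s p => [|c s IHs] p /=.
  by rewrite leqn0 msize_poly_eq0 => _ /eqP.
case/andP=> cs us szp p0.
have [q Ep] := mfix_eq0 (p0 c (mem_head _ _)).
have [q0|q0] := eqVneq q 0; first by rewrite Ep q0 mulr0.
rewrite Ep (IHs q us) ?mulr0 //.
  by rewrite Ep msize_mulXsubC // in szp.
move=> c' c's; have : mfix j c' p = 0 by apply: p0; rewrite inE c's orbT.
rewrite Ep rmorphM rmorphB /= /mfix msubstX msubstC unlift_none => /eqP.
rewrite mulf_eq0 -mpolyCB mpolyC_eq0 subr_eq0 => /orP[/eqP cc'|/eqP//].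
by rewrite -cc' c's in cs.
Qed.

Lemma mfix_multiplicity (K : idomainType) n (j : 'I_n.+1) (c : K)
    (p : {mpoly K[n.+1]}) : p != 0 ->
  exists e q, p = ('X_j - c%:MP) ^+ e * q /\ mfix j c q != 0.
Proof.
have [m] := ubnP (msize p); elim: m p => // m IHm p szp p0.
have [/mfix_eq0[q Ep]|] := eqVneq (mfix j c p) 0; last first.
  by exists 0%N, p; rewrite mul1r.
have q0 : q != 0 by apply: contra_neq p0 => q0; rewrite Ep q0 mulr0.
rewrite Ep msize_mulXsubC // ltnS in szp.
have [e [q' [Eq q'0]]] := IHm q szp q0.
by exists e.+1, q'; rewrite Ep Eq mulrA -exprS.
Qed.

Section Infinite.
Context {K : fieldType} (charK : [pchar K] =i pred0).

Lemma pchar0_natr_inj : injective (fun i : nat => i%:R : K).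
Proof.
move=> i j; wlog le : i j / (i <= j)%N => [th eij|].
  by case/orP: (leq_total i j) => le; [|apply/esym]; apply: th.
move/eqP; rewrite eq_sym -subr_eq0 -natrB // ((pcharf0P K).1 charK) subn_eq0 => le'.
by apply/eqP; rewrite eqn_leq le.
Qed.

Lemma exists_mfix_neq0 n (j : 'I_n.+1) (p : {mpoly K[n.+1]}) :
  p != 0 -> exists c, mfix j c p != 0.
Proof.
move=> p0; pose s : seq K := [seq i%:R | i <- iota 0 (msize p)].
have us : uniq s by rewrite (map_inj_uniq pchar0_natr_inj) iota_uniq.
have [/hasP[c _ pc]|/hasPn nz] := boolP (has (fun c => mfix j c p != 0) s).
  by exists c.
case/eqP: p0; apply: (mfix_all_eq0 (j := j) us); first by rewrite size_map size_iota.
by move=> c /nz /negPn /eqP.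
Qed.

Lemma exists_meval_neq0 n (p : {mpoly K[n]}) :
  p != 0 -> exists v, p.@[v] != 0.
Proof.
elim: n p => [|n IHn] p p0.
  exists (fun=> 0); rewrite (nvar0_mpolyC p) mevalC.
  by apply: contra_neq p0 => p0; rewrite (nvar0_mpolyC p) p0 mpolyC0.
have [c /IHn[v pv]] := exists_mfix_neq0 ord0 p0.
by exists (vfix ord0 c v); rewrite -meval_mfix.
Qed.

End Infinite.

(** * Linear algebra over a domain *)

Local Notation "x %:F" := (tofrac x).

Lemma exists_linear_relation (K : fieldType) (I J : finType) (c : I -> J -> K) :
  (#|J| < #|I|)%N ->
  exists2 u : I -> K, (exists i, u i != 0) & forall j, \sum_i u i * c i j = 0.
Proof.
move=> ltJI; pose A := \matrix_(i < #|I|, j < #|J|) c (enum_val i) (enum_val j).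
have : kermx A != 0.
  rewrite kermx_eq0 /row_free; apply: contraL ltJI => /eqP <-.
  by rewrite -leqNgt rank_leq_col.
rewrite -nz_row_eq0; set u := nz_row _ => /eqP u0.
have uA : u *m A = 0 by apply/sub_kermxP/nz_row_sub.
exists (fun i => u 0 (enum_rank i)).
  have [i ui|u00] := pickP (fun i => u 0 i != 0).
    by exists (enum_val i); rewrite enum_valK.
  case: u0; apply/rowP => i; rewrite mxE.
  by apply/eqP; move/negbFE: (u00 i).
move=> j; have /rowP/(_ (enum_rank j)) := uA; rewrite !mxE => uAj.
rewrite -[RHS]uAj [LHS](reindex (@enum_val I predT)) /=; last exact/onW_bij/enum_val_bij.
by apply: eq_bigr => i _; rewrite enum_valK mxE enum_rankK.
Qed.

Lemma fraction_numden (R : idomainType) (x : {fraction R}) :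
  exists n d : R, d != 0 /\ x * d%:F = n%:F.
Proof.
elim/quotW: x => f; exists (frac f).1, (frac f).2; split; first exact: denom_ratioP.
apply/eqP; rewrite !piE /= /FracField.equivf /=.
rewrite /FracField.mulf !numden_Ratio ?mulf_neq0 ?oner_neq0 ?denom_ratioP //.
by rewrite !mulr1 mulrC.
Qed.

(** Over the fraction field either the columns are dependent, and denominators
    can be cleared in a relation, or some maximal minor is nonzero. *)
Lemma kernel_or_minor (R : idomainType) k M (A : 'M[R]_(k, M)) :
  (exists2 a : 'I_M -> R, exists j, a j != 0 &
      forall i, \sum_j A i j * a j = 0) \/
  exists g : 'I_M -> 'I_k, \det (\matrix_(i, j) A (g i) j) != 0.
Proof.
pose B := map_mx (@tofrac R) A.
have [fullB|nfullB] := boolP (row_full B).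
  right; exists (fullrankfun fullB).
  have := fullrowsub_unit fullB; rewrite unitmxE unitfE.
  have -> : rowsub (fullrankfun fullB) B =
            map_mx (@tofrac R) (\matrix_(i, j) A (fullrankfun fullB i) j).
    by apply/matrixP => i j; rewrite !mxE.
  by rewrite det_map_mx tofrac_eq0.
left.
have : cokermx B != 0 by rewrite cokermx_eq0.
rewrite -trmx_eq0 -nz_row_eq0; set u := nz_row _ => u0.
have Bu : B *m u^T = 0.
  have /submxP[D ->] : (u <= (cokermx B)^T)%MS by apply: nz_row_sub.
  by rewrite trmx_mul trmxK mulmxA mulmx_coker mul0mx.
have nd j : exists nd : R * R, (nd.2 != 0) && (u 0 j * nd.2%:F == nd.1%:F).
  by have [n [d [d0 /eqP e]]] := fraction_numden (u 0 j); exists (n, d); rewrite d0.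
have [nd_ ndP] := fin_all_exists nd.
(* The kernel vector times the product of all denominators. *)
exists (fun j => (nd_ j).1 * \prod_(i | i != j) (nd_ i).2).
  have [j uj|u00] := pickP (fun i => u 0 i != 0); last first.
    case/eqP: u0; apply/rowP => i; rewrite mxE.
    by apply/eqP; move/negbFE: (u00 i).
  exists j; have /andP[d0 /eqP e] := ndP j.
  rewrite mulf_neq0 //; last first.
    by apply/prodf_neq0 => i _; case/andP: (ndP i).
  by rewrite -tofrac_eq0 -e mulf_neq0 // tofrac_eq0.
move=> i; apply/eqP; rewrite -tofrac_eq0 rmorph_sum /=.
have /matrixP/(_ i 0) := Bu; rewrite !mxE => Bui.
apply/eqP; transitivity ((\sum_j B i j * u^T j 0) * (\prod_i (nd_ i).2)%:F).
  rewrite mulr_suml; apply: eq_bigr => j _.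
  rewrite [in RHS](bigD1 j) //= !tofracM.
  have /andP[d0 /eqP <-] := ndP j.
  by rewrite !mxE !mulrA.
by rewrite Bui mul0r.
Qed.

(** * Algebraic independence *)

Section AlgebraicIndependence.
Context {K : fieldType}.

Definition algebraically_independent k M (f : 'I_k -> {mpoly K[M]}) :=
  forall P, msubst f P = 0 -> P = 0.

Lemma msizeM_leq M (p q : {mpoly K[M]}) a b :
  (msize p <= a.+1 -> msize q <= b.+1 -> msize (p * q) <= (a + b).+1)%N.
Proof.
have [->|p0] := eqVneq p 0; first by rewrite mul0r msize0.
have [->|q0] := eqVneq q 0; first by rewrite mulr0 msize0.
by rewrite msizeM //; move: (msize p) (msize q) => x y; lia.
Qed.

Lemma msizeX_leq M (p : {mpoly K[M]}) e i :
  (msize p <= e.+1 -> msize (p ^+ i) <= (i * e).+1)%N.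
Proof.
move=> pe; elim: i => [|i IHi]; first by rewrite expr0 msize1.
by rewrite exprS mulSn; apply: msizeM_leq.
Qed.

Lemma msize_prod_leq M (I : Type) (r : seq I) (F : I -> {mpoly K[M]}) e :
  (forall i, msize (F i) <= e.+1)%N ->
  (msize (\prod_(i <- r) F i) <= (\sum_(i <- r) e).+1)%N.
Proof.
move=> Fe; elim: r => [|i r IHr]; first by rewrite !big_nil msize1.
by rewrite !big_cons; apply: msizeM_leq.
Qed.

(** Counting: the [D ^ k] products of powers [< D] of the [f i] have degree at
    most [k * D * e], so that for large [D] they outnumber the monomials in
    [M] variables of that degree as soon as [M < k]. *)
Lemma algebraically_independent_leq k M (f : 'I_k -> {mpoly K[M]}) :
  algebraically_independent f -> (k <= M)%N.
Proof.
move=> fP; rewrite leqNgt; apply/negP => ltMk.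
pose e := (\max_i msize (f i))%N.
pose D := (((k * e).+1 ^ M).+1)%N; pose B := ((k * (D * e)).+1)%N.
pose mon (a : {ffun 'I_k -> 'I_D}) : 'X_{1..k} := [multinom nat_of_ord (a i) | i < k].
have ltc : (#|{ffun 'I_M -> 'I_B}| < #|{ffun 'I_k -> 'I_D}|)%N.
  rewrite !card_ffun !card_ord.
  have leBD : (B <= (k * e).+1 * D)%N by rewrite /B mulSn mulnCA; lia.
  apply: (@leq_ltn_trans (((k * e).+1 * D) ^ M)).
    by case: (M) => // M'; rewrite leq_exp2r.
  rewrite expnMn; apply: (@leq_trans (D ^ M.+1)); last first.
    by rewrite leq_exp2l // ltnS expn_gt0.
  by rewrite expnS ltn_mul2r expn_gt0 /= /D.
have monB (a : {ffun 'I_k -> 'I_D}) : (msize (msubst f 'X_[mon a]) <= B)%N.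
  rewrite /msubst mmapX /mmap1.
  have -> : B = (\sum_(i < k) D * e).+1 by rewrite sum_nat_const card_ord.
  apply: msize_prod_leq => i; rewrite mnmE.
  apply: leq_trans (msizeX_leq (e := e) _ _) _; last first.
    by rewrite ltnS leq_mul2r ltnW ?orbT.
  by apply: leqW; apply: (leq_bigmax i).
(* Monomials of degree below [B] have exponents below [B]: there are at most
   [B ^ M] of them, and hence fewer than products. *)
pose bmon (b : {ffun 'I_M -> 'I_B}) : 'X_{1..M} := [multinom nat_of_ord (b i) | i < M].
have [u [a ua] Eu] := exists_linear_relation
  (fun a b => (msubst f 'X_[mon a])@_(bmon b)) ltc.
pose P := \sum_a u a *: 'X_[mon a] : {mpoly K[k]}.
have mon_inj : injective mon.
  move=> a1 a2 /mnmP E; apply/ffunP => i; apply: val_inj.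
  by have := E i; rewrite !mnmE.
have P0 : P = 0.
  apply: fP; apply/mpolyP => m; rewrite mcoeff0 /P !rmorph_sum /= raddf_sum /=.
  have [mB|mB] := ltnP (mdeg m) B; last first.
    apply: big1 => c _; rewrite msubstZ mcoeffZ [_@_m]memN_msupp_eq0 ?mulr0 //.
    by apply: msize_mdeg_ge; apply: leq_trans mB.
  have lt_m i : (m i < B)%N.
    by apply: leq_ltn_trans mB; rewrite mdegE (bigD1 i) //= leq_addr.
  rewrite -[RHS](Eu [ffun i => Ordinal (lt_m i)]); apply: eq_bigr => c _.
  rewrite msubstZ mcoeffZ; congr (_ * _@_ _).
  by apply/mnmP => i; rewrite mnmE ffunE.
case/eqP: ua; have /(congr1 (mcoeff (mon a))) := P0.
rewrite mcoeff0 /P raddf_sum /= (bigD1 a) //= mcoeffZ mcoeffX eqxx mulr1.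
rewrite big1 ?addr0 // => c /negPf nc.
by rewrite mcoeffZ mcoeffX (inj_eq mon_inj) nc mulr0.
Qed.

End AlgebraicIndependence.

(** * The Jacobian criterion *)

Section Jacobian.
Context {K : fieldType} (charK : [pchar K] =i pred0).

Definition jacobian k M (f : 'I_k -> {mpoly K[M]}) (v : 'I_M -> K) : 'M[K]_(k, M) :=
  \matrix_(i, j) (f i)^`M(j).@[v].

(** A vector field [a] that kills the [f i] kills all of [K[f]]. If [a j] does
    not vanish identically on the hyperplane [x_j = c], then restriction to
    this hyperplane is injective on [K[f]]: a function [(x_j - c)^e q] with [e
    > 0] and [q] nonzero on the hyperplane is not killed by [a], because then
    [e * a j * q] would vanish on the hyperplane. *)
Lemma algebraically_independent_mfix k M (f : 'I_k -> {mpoly K[M.+1]})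
    (a : 'I_M.+1 -> {mpoly K[M.+1]}) j c :
  (forall i, \sum_p (f i)^`M(p) * a p = 0) -> mfix j c (a j) != 0 ->
  algebraically_independent f ->
  algebraically_independent (fun i => mfix j c (f i)).
Proof.
move=> fa aj fP P; rewrite -msubst_comp -/(mfix j c _) => Pf.
pose Y (g : {mpoly K[M.+1]}) := \sum_p g^`M(p) * a p.
have YP : Y (msubst f P) = 0.
  rewrite /Y (eq_bigr (fun p => \sum_i msubst f P^`M(i) * ((f i)^`M(p) * a p))).
    rewrite exchange_big big1 // => i _.
    by rewrite -mulr_sumr fa mulr0.
  move=> p _; rewrite mderiv_msubst mulr_suml.
  by apply: eq_bigr => i _; rewrite mulrA.
have [/fP//|g0] := eqVneq (msubst f P) 0.
have [[|e] [q [Eg q0]]] := mfix_multiplicity j c g0.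
  by case/eqP: q0; rewrite -Pf Eg mul1r.
pose L : {mpoly K[M.+1]} := 'X_j - c%:MP.
have L0 : L != 0.
  apply: contraNneq g0 => L0; rewrite Eg -/L L0 expr0n mul0r //.
have YL : forall g, Y (L ^+ e.+1 * g) = L ^+ e * (e.+1%:R * a j * g + L * Y g).
  move=> g; rewrite /Y.
  have dL i p : (L ^+ i.+1)^`M(p) = i.+1%:R * L ^+ i * (j == p)%:R.
    elim: i => [|i IHi].
      by rewrite expr0 expr1 /L mderivB mderivXU mderivC subr0 !mul1r.
    rewrite exprS mderivM IHi /L mderivB mderivXU mderivC subr0 -/L.
    by rewrite -[i.+2%:R]natr1 !exprS; move: (L) (L ^+ i) (_ == _)%:R => X Y' b; ring.
  rewrite (eq_bigr (fun p => (j == p)%:R * (e.+1%:R * L ^+ e * a p * g) +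
              L ^+ e.+1 * (g^`M(p) * a p))); last first.
    by move=> p _; rewrite mderivM dL; ring.
  rewrite big_split -mulr_sumr (bigD1 j) //= eqxx big1 ?addr0; last first.
    by move=> p; rewrite eq_sym => /negPf ->; rewrite mul0r.
  by rewrite mul1r exprS; ring.
move: YP; rewrite Eg YL => /eqP; rewrite mulf_eq0 expf_eq0 (negPf L0) andbF /=.
move=> /eqP /(congr1 (mfix j c)); rewrite rmorph0 rmorphD !rmorphM /=.
have -> : mfix j c L = 0.
  by rewrite /L rmorphB /= /mfix msubstX msubstC unlift_none subrr.
rewrite mul0r addr0.
move/eqP; rewrite !mulf_eq0 (negPf aj) (negPf q0) !orbF rmorph_nat.
rewrite -mpolyC_nat mpolyC_eq0 ((pcharf0P K).1 charK) //.
Qed.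

Lemma jacobian_mfix k M (f : 'I_k -> {mpoly K[M.+1]}) j c v :
  jacobian (fun i => mfix j c (f i)) v = col' j (jacobian f (vfix j c v)).
Proof. by apply/matrixP => i p; rewrite !mxE mfix_mderiv meval_mfix. Qed.

(** Induction on the number of variables: either some vector field kills all
    the [f i], and one restricts to a hyperplane, or the generic rank of the
    differentials is the number of variables, which is at least [k]. *)
Theorem algebraically_independent_jacobian k M (f : 'I_k -> {mpoly K[M]}) :
  algebraically_independent f -> exists v, row_free (jacobian f v).
Proof.
elim: M f => [|M IHM] f fP; have lekM := algebraically_independent_leq fP.
  by exists (fun=> 0); rewrite /row_free eqn_leq rank_leq_row (leq_trans lekM).
have [[a [j aj] fa]|[g]] :=
    kernel_or_minor (\matrix_(i < k, p < M.+1) (f i)^`M(p)).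
  have [c ajc] := exists_mfix_neq0 charK j aj.
  have [|v fv] := IHM _ (algebraically_independent_mfix _ ajc fP).
    by move=> i; rewrite -[RHS](fa i); apply: eq_bigr => p _; rewrite !mxE.
  exists (vfix j c v); rewrite jacobian_mfix in fv.
  apply: inj_row_free => u uJ; apply: (row_free_inj fv); rewrite mul0mx.
  apply/matrixP => x y; have /matrixP/(_ x (lift j y)) := uJ.
  by rewrite !mxE => uJxy; rewrite -[RHS]uJxy; apply: eq_bigr => i _; rewrite !mxE.
move=> /(exists_meval_neq0 charK)[v]; rewrite -det_map_mx /= => gv.
exists v; rewrite /row_free eqn_leq rank_leq_row /=.
apply: leq_trans lekM _.
have /mxrank_unit {1}<- : rowsub g (jacobian f v) \in unitmx; last first.
  exact/mxrankS/rowsub_sub.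
rewrite unitmxE unitfE; congr (\det _ != 0): gv.
by apply/matrixP => i p; rewrite !mxE.
Qed.

End Jacobian.

(** * Chains of irreducible sets *)

Section Chains.
Local Open Scope classical_set_scope.
Context {K : fieldType} (charK : [pchar K] =i pred0).

Lemma poly_eval_eq0 (q : {poly K}) : (forall x, x != 0 -> q.[x] = 0) -> q = 0.
Proof.
move=> q0; apply/eqP/negPn/negP => nz.
pose s : seq K := [seq i.+1%:R | i <- iota 0 (size q)].
have us : uniq s.
  by rewrite map_inj_uniq ?iota_uniq // => i j /(pchar0_natr_inj charK)[].
have /(max_poly_roots nz)/(_ us) : all (root q) s.
  apply/allP => _ /mapP[i _ ->]; apply/rootP/q0.
  by rewrite ((pcharf0P K).1 charK).
by rewrite size_map size_iota ltnn.
Qed.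

Lemma meval_scale n e (f : {mpoly K[n]}) a v :
  f \is e.-homog -> f.@[fun i => a * v i] = a ^+ e * f.@[v].
Proof.
move=> fe; rewrite !mevalE big_seq [in RHS]big_seq mulr_sumr.
apply: eq_bigr => m mf; rewrite mulrCA; congr (_ * _).
rewrite (eq_bigr (fun i => a ^+ m i * v i ^+ m i)); last first.
  by move=> i _; rewrite exprMn.
by rewrite big_split prodrXr -mdegE (dhomog_mf fe).
Qed.

(** Along the punctured line the values of [f] form a polynomial in the
    scaling factor, whose coefficients are the values of the homogeneous
    components; in characteristic zero there are infinitely many factors. *)
Lemma pihomog_eval_eq0 n (f : {mpoly K[n]}) v :
  (forall a, a != 0 -> f.@[fun i => a * v i] = 0) ->
  forall e, (pihomog mdeg e f).@[v] = 0.
Proof.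
move=> f0 e; have [s les] : exists s, (msize f <= s)%N by exists (msize f).
pose q : {poly K} := \poly_(j < s) (pihomog mdeg j f).@[v].
have /polyP/(_ e) : q = 0.
  apply: poly_eval_eq0 => a /f0 fa; rewrite horner_poly -[RHS]fa.
  rewrite [in RHS](pihomog_partitionE les) raddf_sum /=.
  by apply: eq_bigr => j _; rewrite (meval_scale _ _ (pihomogP _ _ _)) mulrC.
rewrite coef0 coef_poly; case: ltnP => // le_f _.
rewrite pihomogE big_seq_cond big1 ?meval0 // => m /andP[/msize_mdeg_lt mf /eqP me].
by rewrite me ltnNge (leq_trans les le_f) in mf.
Qed.

Context {V : vectType K}.
Local Notation N := (\dim {:V}).
Implicit Types (Z : set (proj V)) (f g : {mpoly K[N]}).

Definition hcoord (v : V) (i : 'I_N) : K := coord (vbasis {:V}) i v.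

Definition vanishes_on f Z := forall P v, Z P -> v \in line P -> f.@[hcoord v] = 0.

Lemma hcoordZ a v : hcoord (a *: v) =1 (fun i => a * hcoord v i).
Proof. by move=> i; rewrite /hcoord linearZ. Qed.

Lemma dim_line (P : proj V) : \dim (line P) = 1%N.
Proof. exact: eqP (svalP P). Qed.

Lemma proj_eq (P Q : proj V) : line P = line Q -> P = Q.
Proof.
case: P Q => [U dU] [W dW]; rewrite /line /= => E.
by move: dU; rewrite E => dU; rewrite (bool_irrelevance dU dW).
Qed.

Lemma line_scalar (P : proj V) v w : v \in line P -> v != 0 -> w \in line P ->
  exists a, w = a *: v.
Proof.
move=> vP v0 wP; apply/vlineP; suff -> : <[v]>%VS = line P by [].
by apply/eqP; rewrite eqEdim -memvE vP dim_vline v0 dim_line.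
Qed.

Lemma line_generator (P : proj V) : exists2 v, v \in line P & v != 0.
Proof.
exists (vpick (line P)); first exact: memv_pick.
by rewrite vpick0 -dimv_eq0 dim_line.
Qed.

Lemma hcoord_eq0 v : (forall i, hcoord v i = 0) -> v = 0.
Proof.
move=> v0; rewrite (coord_vbasis (memvf v)) big1 // => i _.
by rewrite -/(hcoord v i) v0 scale0r.
Qed.

Lemma zero_locus1_closed f : f \is homog mdeg -> zariski_closed (zero_locus [set f]).
Proof. by move=> fh; exists [set f] => // _ ->. Qed.

Lemma vanishes_on_zero_locus1 f Z :
  vanishes_on f Z <-> Z `<=` zero_locus [set f].
Proof.
split=> [fZ P ZP f' v -> vP|ZC P v /ZC fP]; first exact: fZ ZP vP.
exact: fP.
Qed.

Lemma vanishes_on_pihomog f Z e : vanishes_on f Z -> vanishes_on (pihomog mdeg e f) Z.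
Proof.
move=> fZ P v ZP vP; apply: pihomog_eval_eq0 => a _.
by rewrite -(meval_eq _ (hcoordZ a v)); apply: fZ ZP _; rewrite memvZ.
Qed.

(** Closed sets are cut out by homogeneous polynomials, but [f] may be
    replaced by its components. *)
Lemma vanishes_on_closure f Z : vanishes_on f Z -> vanishes_on f (zariski_closure Z).
Proof.
move=> fZ P v ZP vP; rewrite (pihomog_partitionE (leqnn (msize f))) raddf_sum /=.
apply: big1 => e _; apply: (ZP (zero_locus [set pihomog mdeg e f])) vP => //.
split; last exact/vanishes_on_zero_locus1/vanishes_on_pihomog.
by apply: zero_locus1_closed; apply/homogP; exists e; apply: pihomogP.
Qed.

(** The vanishing ideal of an irreducible set is prime. One homogeneous factor
    is enough for the use made of it below; the other one is split into its
    components. *)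
Lemma irreducible_prime Z f g : irreducible_closed Z -> f \is homog mdeg ->
  vanishes_on (f * g) Z -> ~ vanishes_on f Z -> vanishes_on g Z.
Proof.
move=> [_ _ Zirr] fh fgZ fZ.
suff gZ e : vanishes_on (pihomog mdeg e g) Z.
  move=> P v ZP vP; rewrite (pihomog_partitionE (leqnn (msize g))) raddf_sum /=.
  by apply: big1 => e _; apply: gZ ZP vP.
have gh : pihomog mdeg e g \is homog mdeg.
  by apply/homogP; exists e; apply: pihomogP.
apply/vanishes_on_zero_locus1.
have [||P ZP|/vanishes_on_zero_locus1/fZ|//] :=
  Zirr (zero_locus [set f]) (zero_locus [set pihomog mdeg e g]);
  try exact: zero_locus1_closed; last by [].
have [v vP v0] := line_generator P.
have [k fk] := homogP _ _ fh.
have [fv|fv] := eqVneq f.@[hcoord v] 0.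
  left=> _ w -> /(line_scalar vP v0)[a ->].
  by rewrite (meval_eq _ (hcoordZ a v)) (meval_scale _ _ fk) fv mulr0.
right=> _ w -> /(line_scalar vP v0)[a ->].
rewrite (meval_eq _ (hcoordZ a v)) (meval_scale _ _ (pihomogP _ _ _)).
rewrite [X in _ * X]pihomog_eval_eq0 ?mulr0 // => {}a a0.
rewrite -(meval_eq _ (hcoordZ a v)).
have avP : a *: v \in line P by rewrite memvZ.
move/eqP: (fgZ P _ ZP avP); rewrite mevalM mulf_eq0.
rewrite (meval_eq f (hcoordZ a v)) (meval_scale _ _ fk) mulf_eq0 (negPf fv).
by rewrite expf_eq0 (negPf a0) andbF => /eqP.
Qed.

(** Induction on the length, keeping the independence modulo the ideal of [C
    k]. The new element is taken in the ideal of [C k] but not in that of [C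
    k.+1]. It occupies the variable [X_0], so that a relation modulo the
    latter ideal can be divided by [X_0] as long as possible, and then
    restricts to a nonzero relation of the other elements modulo the ideal of
    [C k]. *)
Lemma chain_independent (C : nat -> set (proj V)) k :
  (forall i, (i <= k)%N -> irreducible_closed (C i)) ->
  (forall i, (i < k)%N -> C i `<` C i.+1) ->
  exists g : 'I_k.+1 -> {mpoly K[N]},
    forall P, vanishes_on (msubst g P) (C k) -> P = 0.
Proof.
elim: k => [|k IHk] Cirr Clt.
  have [_ [P CP] _] := Cirr 0 (leqnn 0).
  have [v vP v0] := line_generator P.
  have [b vb] : exists b, hcoord v b != 0.
    have [b vb|all0] := pickP (fun b => hcoord v b != 0); first by exists b.
    case/eqP: v0; apply: hcoord_eq0 => b.
    by apply/eqP; move/negbFE: (all0 b).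
  (* A coordinate that is nonzero on the line takes all values there. *)
  exists (fun=> 'X_b) => Q Qv; apply/eqP/negPn/negP => /(exists_meval_neq0 charK)[x].
  have := Qv P ((x ord0 / hcoord v b) *: v) CP; rewrite memvZ // => /(_ isT) E.
  case/eqP; rewrite -[RHS]E meval_msubst; apply: meval_eq => i.
  by rewrite mevalXU hcoordZ divfK // ord1.
have [i lei|i lti|g gP] := IHk.
- by apply: Cirr; apply: leqW.
- by apply: Clt; apply: leqW.
have [[I Ih CkE] _ _] := Cirr k (leqnSn k).
have [Clek nClek] := Clt k (ltnSn k).
have [f If nf] : exists2 f, I f & ~ vanishes_on f (C k.+1).
  apply: contrapT => nI; apply: nClek => P CP; rewrite CkE => f v If vP.
  by apply: contrapT => fv; apply: nI; exists f => // fC; exact: fv (fC _ _ CP vP).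
have fCk : vanishes_on f (C k) by move=> P v; rewrite CkE => /(_ f v If).
pose h i : {mpoly K[N]} := if unlift ord0 i is Some i' then g i' else f.
exists h => P PC; apply/eqP/negPn/negP => P0.
have [e [Q [EP Q0]]] := mfix_multiplicity ord0 0 P0.
have {}PC : vanishes_on (f ^+ e * msubst h Q) (C k.+1).
  move: PC; rewrite EP rmorphM rmorphXn rmorphB /= msubstX msubstC mpolyC0 subr0.
  by rewrite /h unlift_none.
have QC : vanishes_on (msubst h Q) (C k.+1).
  elim: e PC {EP} => [|e IHe]; first by rewrite mul1r.
  rewrite exprS -mulrA => /(irreducible_prime (Cirr k.+1 (leqnn _)) (Ih f If)).
  by move=> /(_ nf)/IHe.
case/eqP: Q0; apply: gP => P' v CP' vP'.
rewrite -[RHS](QC P' v (Clek _ CP') vP') [LHS]meval_msubst.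
rewrite meval_mfix [RHS]meval_msubst; apply: meval_eq => i; rewrite /vfix /h.
by case: unlift => // ; rewrite (fCk _ _ CP').
Qed.

(** The hypothesis makes pullbacks along [phi] of functions independent on [Z]
    algebraically independent; the chain rule then bounds the rank of their
    differentials by that of [phi]. *)
Lemma chain_jacobian_rank M (phi : 'I_N -> {mpoly K[M]}) Z k :
  (forall f, msubst phi f = 0 -> vanishes_on f Z) ->
  has_irreducible_chain Z k -> exists v, (k < \rank (jacobian phi v))%N.
Proof.
move=> phiZ [C [Cirr Clt]].
have [i lei|//|g gP] := @chain_independent C k; first by have [] := Cirr i lei.
have [|v] := algebraically_independent_jacobian charK
    (f := fun i => msubst phi (g i)).
  move=> P; rewrite -msubst_comp => /phiZ PZ; apply: gP => Q v CQ.
  by apply: PZ; have [_] := Cirr k (leqnn k); apply.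
have -> : jacobian (fun i => msubst phi (g i)) v =
          jacobian g (fun b => (phi b).@[v]) *m jacobian phi v.
  apply/matrixP => i j; rewrite !mxE mderiv_msubst raddf_sum /=.
  by apply: eq_bigr => b _; rewrite !mxE mevalM meval_msubst.
by move=> /eqP gv; exists v; rewrite -[k.+1]gv mxrankM_maxr.
Qed.

(** * Existence of the dimension *)

(** A point is cut out by the two-by-two minors of the matrix of its own and
    the variable coordinates. *)
Lemma singleton_irreducible (P : proj V) : irreducible_closed [set P].
Proof.
split; last 2 first.
- by exists P.
- by move=> A B _ _ /(_ P erefl)[AP|BP]; [left|right] => _ ->.
have [v vP v0] := line_generator P.
pose F a b : {mpoly K[N]} := (hcoord v a) *: 'X_b - (hcoord v b) *: 'X_a.
exists [set f | exists a b, f = F a b].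
  move=> _ [a [b ->]]; apply/homogP; exists 1%N.
  by apply: rpredB; apply: dhomogZ; rewrite dhomogX; apply/eqP/mdeg1.
apply/seteqP; split=> [_ -> _ w [a [b ->]] /(line_scalar vP v0)[c ->]|Q QP].
  by rewrite (meval_eq _ (hcoordZ c v)) mevalB !mevalZ !mevalXU; ring.
have [w wQ w0] := line_generator Q.
have [b vb] : exists b, hcoord v b != 0.
  have [b vb|all0] := pickP (fun b => hcoord v b != 0); first by exists b.
  case/eqP: v0; apply: hcoord_eq0 => b.
  by apply/eqP; move/negbFE: (all0 b).
have wE : w = (hcoord w b / hcoord v b) *: v.
  apply/eqP; rewrite -subr_eq0; apply/eqP/hcoord_eq0 => a.
  have := QP (F a b) w (ex_intro _ a (ex_intro _ b erefl)) wQ.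
  rewrite mevalB !mevalZ !mevalXU -!/(hcoord w _) => /eqP.
  rewrite subr_eq0 /hcoord linearB linearZ /= -!/(hcoord _ _) => /eqP E.
  apply/eqP; rewrite subr_eq0; apply/eqP/(mulfI vb).
  by rewrite -E; field.
apply: proj_eq; apply/eqP; rewrite eqEdim !dim_line leqnn andbT.
have /eqP <- : <[w]>%VS == line Q.
  by rewrite eqEdim -memvE wQ dim_vline w0 dim_line.
by rewrite -memvE wE memvZ.
Qed.

Lemma proj_dim_exists Z m : Z !=set0 ->
  (forall k, has_irreducible_chain Z k -> (k <= m)%N) ->
  exists2 k, is_proj_dim Z k & has_irreducible_chain Z k.
Proof.
move=> [P ZP] bound.
have ex0 : exists k, `[< has_irreducible_chain Z k >].
  exists 0%N; apply/asboolP; exists (fun=> [set P]); split=> // i _.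
  by split; [apply: singleton_irreducible|move=> _ ->].
have le_m k : `[< has_irreducible_chain Z k >] -> (k <= m)%N.
  by move/asboolP/bound.
case: (ex_maxnP ex0 le_m) => k /asboolP kP maxk.
by exists k => //; split=> // j /asboolP/maxk.
Qed.

End Chains.

(** * Polynomial maps between vector spaces *)

Section PolynomialMaps.
Context {K : fieldType} {M : nat}.
Implicit Types (v u : 'I_M -> K) (p : {mpoly K[M]}).

(** The differential of [p] at [v] applied to [u]. *)
Definition dmeval p v u : K := \sum_j p^`M(j).@[v] * u j.

Lemma dmevalC c v u : dmeval c%:MP v u = 0.
Proof. by apply: big1 => j _; rewrite mderivC meval0 mul0r. Qed.

Lemma dmevalX i v u : dmeval 'X_i v u = u i.
Proof.
rewrite /dmeval (bigD1 i) //= mderivXU eqxx meval1 mul1r big1 ?addr0 // => j.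
by rewrite eq_sym => /negPf ne; rewrite mderivXU ne meval0 mul0r.
Qed.

Lemma dmevalM p q v u :
  dmeval (p * q) v u = dmeval p v u * q.@[v] + p.@[v] * dmeval q v u.
Proof.
rewrite /dmeval mulr_suml mulr_sumr -big_split; apply: eq_bigr => j _ /=.
by rewrite mderivM mevalD !mevalM; ring.
Qed.

(** A polynomial map to a possibly infinite-dimensional space, given together
    with its derivative [dw v u] at [v] in the direction [u]; the two share
    one presentation, which makes the calculus below coordinate-free. *)
Definition polymap (W : lmodType K) (w : ('I_M -> K) -> W)
    (dw : ('I_M -> K) -> ('I_M -> K) -> W) :=
  exists s : seq ({mpoly K[M]} * W),
    (forall v, w v = \sum_(x <- s) x.1.@[v] *: x.2) /\
    (forall v u, dw v u = \sum_(x <- s) dmeval x.1 v u *: x.2).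

Lemma polymap_const (W : lmodType K) (c : W) :
  polymap (fun=> c) (fun=> fun=> 0).
Proof.
exists [:: (1%:MP, c)]; split=> [v|v u]; rewrite big_seq1 /=.
  by rewrite mevalC scale1r.
by rewrite dmevalC scale0r.
Qed.

Lemma polymap_coord (W : lmodType K) (i : 'I_M) (c : W) :
  polymap (fun v => v i *: c) (fun _ u => u i *: c).
Proof.
by exists [:: ('X_i, c)]; split=> [v|v u]; rewrite big_seq1 /= ?mevalXU ?dmevalX.
Qed.

Lemma polymap_sum (W : lmodType K) (I : Type) (r : seq I) (P : pred I)
    (w : I -> ('I_M -> K) -> W) dw :
  (forall i, polymap (w i) (dw i)) ->
  polymap (fun v => \sum_(i <- r | P i) w i v) (fun v u => \sum_(i <- r | P i) dw i v u).
Proof.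
move=> wP; elim: r => [|i r [s [E D]]].
  by exists [::]; split=> [v|v u]; rewrite !big_nil.
case Pi: (P i); last first.
  by exists s; split=> [v|v u]; rewrite big_cons Pi ?E ?D.
have [s' [E' D']] := wP i; exists (s' ++ s).
by split=> [v|v u]; rewrite big_cons Pi big_cat ?E ?D ?E' ?D'.
Qed.

Lemma polymap_linear (W W' : lmodType K) (h : {linear W -> W'})
    (w : ('I_M -> K) -> W) dw :
  polymap w dw -> polymap (fun v => h (w v)) (fun v u => h (dw v u)).
Proof.
move=> [s [E D]]; exists [seq (x.1, h x.2) | x <- s].
split=> [v|v u]; rewrite big_map ?E ?D linear_sum;
  by apply: eq_bigr => x _; rewrite linearZ.
Qed.

Lemma polymapM n (w1 w2 : ('I_M -> K) -> {mpoly K[n]}) dw1 dw2 :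
  polymap w1 dw1 -> polymap w2 dw2 ->
  polymap (fun v => w1 v * w2 v) (fun v u => dw1 v u * w2 v + w1 v * dw2 v u).
Proof.
move=> [s1 [E1 D1]] [s2 [E2 D2]].
exists [seq (x.1 * y.1, x.2 * y.2) | x <- s1, y <- s2].
split=> [v|v u]; rewrite big_allpairs_dep /= E1 E2 ?D1 ?D2.
  rewrite mulr_suml; apply: eq_bigr => x _; rewrite mulr_sumr.
  by apply: eq_bigr => y _; rewrite mevalM -scalerAl -scalerAr scalerA.
rewrite !mulr_suml -big_split; apply: eq_bigr => x _ /=; rewrite !mulr_sumr -big_split.
apply: eq_bigr => y _ /=.
by rewrite dmevalM scalerDl -!scalerAl -!scalerAr !scalerA.
Qed.

Lemma polymap_ext (W : lmodType K) (w w' : ('I_M -> K) -> W) dw dw' :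
  (forall v, w v = w' v) -> (forall v u, dw v u = dw' v u) ->
  polymap w dw -> polymap w' dw'.
Proof.
by move=> Ew Ed [s [E D]]; exists s; split=> [v|v u]; rewrite -?Ew -?Ed.
Qed.

Lemma polymap_prod n (I : finType) (w : I -> ('I_M -> K) -> {mpoly K[n]}) dw P :
  (forall i, polymap (w i) (dw i)) ->
  polymap (fun v => \prod_(i | P i) w i v)
    (fun v u => \sum_(i | P i) dw i v u * \prod_(j | P j && (j != i)) w j v).
Proof.
move=> wP; suff : forall s : seq I, uniq s ->
  polymap (fun v => \prod_(i <- s | P i) w i v)
    (fun v u => \sum_(i <- s | P i) dw i v u * \prod_(j <- s | P j && (j != i)) w j v).
  move/(_ (index_enum I) (index_enum_uniq I)); exact.
elim=> [_|i s IHs /= /andP[nis us]].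
  apply: polymap_ext (polymap_const 1) => [v|v u]; rewrite !big_nil //.
case Pi: (P i); last first.
  apply: polymap_ext (IHs us) => [v|v u]; rewrite big_cons Pi //.
  by apply: eq_bigr => j _; rewrite big_cons Pi.
apply: polymap_ext (polymapM (wP i) (IHs us)) => [v|v u]; rewrite big_cons Pi //.
congr (_ * _ + _).
  rewrite big_cons Pi eqxx /= big_seq_cond [RHS]big_seq_cond.
  apply: eq_bigl => j; case js: (j \in s) => //=.
  by case: eqP => [ji|]; rewrite ?andbT //; rewrite ji (negPf nis) in js.
rewrite mulr_sumr big_seq_cond [RHS]big_seq_cond.
apply: eq_bigr => j /andP[js _]; rewrite big_cons Pi.
have -> : i != j by apply: contraNneq nis => ->.
by rewrite /= mulrCA.
Qed.

Lemma polymap_functional (W : lmodType K) (h : {scalar W})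
    (w : ('I_M -> K) -> W) dw : polymap w dw ->
  exists p, (forall v, p.@[v] = h (w v)) /\ (forall v u, dmeval p v u = h (dw v u)).
Proof.
move=> [s [E D]]; exists (\sum_(x <- s) h x.2 *: x.1).
split=> [v|v u]; rewrite ?E ?D [RHS]linear_sum.
  rewrite [LHS]raddf_sum; apply: eq_bigr => x _ /=.
  by rewrite mevalZ linearZ /= mulrC.
rewrite /dmeval (eq_bigr (fun j => \sum_(x <- s) h x.2 * (x.1^`M(j).@[v] * u j))).
  rewrite exchange_big; apply: eq_bigr => x _ /=.
  by rewrite linearZ /= -mulr_sumr mulrC.
move=> j _; rewrite (raddf_sum (mderiv j)) (raddf_sum (meval v)) mulr_suml; apply: eq_bigr => x _ /=.
by rewrite mderivZ mevalZ mulrA.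
Qed.

End PolynomialMaps.

(** * Ranks of polynomial maps *)

Section RankOfSpan.
Context {K : fieldType} {V : vectType K}.

Lemma exists_unit_minor m n (A : 'M[K]_(m, n)) :
  exists (f : 'I_(\rank A) -> 'I_m) (g : 'I_(\rank A) -> 'I_n),
    mxsub f g A \in unitmx.
Proof.
have frA := maxrowsub_free A.
have fullA : row_full (rowsub (maxrankfun A) A)^T.
  by rewrite -[row_full _]/(\rank _ == _) mxrank_tr.
exists (maxrankfun A), (fullrankfun fullA).
rewrite -unitmx_tr; congr (_ \in unitmx): (fullrowsub_unit fullA).
by apply/matrixP => i j; rewrite !mxE.
Qed.

Lemma mxrank_mxsub_leq m n p q (f : 'I_p -> 'I_m) (g : 'I_q -> 'I_n) (A : 'M[K]_(m, n)) :
  (\rank (mxsub f g A) <= \rank A)%N.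
Proof.
have -> : mxsub f g A = rowsub f (rowsub g A^T)^T.
  by apply/matrixP => i j; rewrite !mxE.
apply: leq_trans (mxrankS (rowsub_sub _ _)) _; rewrite mxrank_tr.
by rewrite -[X in (_ <= X)%N]mxrank_tr; apply/mxrankS/rowsub_sub.
Qed.

Import VectorInternalTheory.

Lemma dim_span_v2r n (X : n.-tuple V) :
  \dim <<X>>%VS = \rank (\matrix_(i, j) v2r (tnth X i) 0 j).
Proof.
have -> : \matrix_(i, j) v2r (tnth X i) 0 j = b2mx X.
  by apply/matrixP => i j; rewrite !mxE.
have -> : <<X>>%VS = mx2vs (b2mx X) by rewrite unlock tvalK; case: _ / (esym _).
by rewrite /dimv /= genmxE.
Qed.

(** A maximal nonzero minor at [v0] is a polynomial in [v]. *)
Lemma dim_span_semicontinuous M (A : finType) (w : A -> ('I_M -> K) -> V) dw v0 :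
  (forall a, polymap (w a) (dw a)) ->
  exists2 q : {mpoly K[M]}, q != 0 & forall v, q.@[v] != 0 ->
    (\dim <<[seq w a v0 | a : A]>> <= \dim <<[seq w a v | a : A]>>)%N.
Proof.
move=> wP.
have coordP a : exists p : 'I_(dim V) -> {mpoly K[M]},
    forall b v, (p b).@[v] = v2r (w a v) 0 b.
  apply: (fin_all_exists (P := fun b p => forall v, p.@[v] = v2r (w a v) 0 b)) => b.
  have lin : scalar (fun x : V => v2r x 0 b).
    by move=> c x y; rewrite linearP !mxE.
  pose h := GRing.isLinear.Build K V K *%R (fun x : V => v2r x 0 b) lin.
  pose H : {scalar V} := HB.pack (fun x : V => v2r x 0 b) h.
  by have [p [pE _]] := polymap_functional H (wP a); exists p => v; rewrite pE.
have {coordP}[p pE] := fin_all_exists coordP.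
pose B v : 'M[K]_(#|A|, dim V) := \matrix_(i, b) (p (enum_val i) b).@[v].
have dimE v : \dim <<[seq w a v | a : A]>>%VS = \rank (B v).
  rewrite -[[seq _ | a : A]]/(tval (codom_tuple (fun a => w a v))) dim_span_v2r.
  congr (\rank _); apply/matrixP => i b; rewrite !mxE pE; congr (v2r _ 0 b).
  by rewrite (tnth_nth (w (enum_val i) v)) /= nth_codom.
have [f [g fg]] := exists_unit_minor (B v0).
pose C : 'M[{mpoly K[M]}]_(\rank (B v0)) := \matrix_(i, j) p (enum_val (f i)) (g j).
have CE v : map_mx (meval v) C = mxsub f g (B v).
  by apply/matrixP => i j; rewrite !mxE.
exists (\det C) => [|v].
  apply: contraTneq fg => C0.
  by rewrite unitmxE unitfE -CE det_map_mx C0 rmorph0 eqxx.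
rewrite -det_map_mx CE !dimE -unitfE -unitmxE => /mxrank_unit {1}<-.
exact: mxrank_mxsub_leq.
Qed.

(** The columns of the Jacobian matrix are the coordinates of derivatives [dw
    v u], and thus lie in [U]. *)
Lemma jacobian_rank_leq M (w : ('I_M -> K) -> V) dw : polymap w dw ->
  exists phi : 'I_(\dim {:V}) -> {mpoly K[M]},
    (forall v b, (phi b).@[v] = hcoord (w v) b) /\
    forall v (U : {vspace V}), (forall u, dw v u \in U) ->
      (\rank (jacobian phi v) <= \dim U)%N.
Proof.
move=> wP.
have [phi phiP] := fin_all_exists (fun b => polymap_functional (coord (vbasis {:V}) b) wP).
exists phi; split=> [v b|v U dwU]; first by have [->] := phiP b.
pose e j : 'I_M -> K := fun i => (i == j)%:R.
have -> : jacobian phi v = (\matrix_(b, k) coord (vbasis {:V}) b (vbasis U)`_k) *m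
                           (\matrix_(k, j) coord (vbasis U) k (dw v (e j))).
  apply/matrixP => b j; rewrite !mxE.
  have [_ /(_ v (e j))] := phiP b.
  rewrite /dmeval (bigD1 j) //= big1 ?addr0; last first.
    by move=> i /negPf ne; rewrite /e ne mulr0.
  rewrite /e eqxx mulr1 => ->; rewrite {1}(coord_vbasis (dwU _)) linear_sum.
  by apply: eq_bigr => k _; rewrite linearZ !mxE /= mulrC.
by apply: leq_trans (mxrankM_maxl _ _) (rank_leq_col _).
Qed.

End RankOfSpan.

(** * Graded pieces of ideals *)

Section GradedPieces.
Context {K : fieldType}.

Lemma dhomog_prodr n (I : Type) (r : seq I) (P : pred I) (F : I -> {mpoly K[n]}) e :
  (forall i, P i -> F i \is (e i).-homog) ->
  \prod_(i <- r | P i) F i \is (\sum_(i <- r | P i) e i)%N.-homog.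
Proof.
move=> FP; apply: (big_rec2 (fun p k => p \is k.-homog)) => [|i k p Pi]; first exact: dhomog1.
by apply: dhomogM; apply: FP.
Qed.

Lemma msubst_homog n k (h : 'I_n -> {mpoly K[k]}) d p :
  (forall i, h i \is 1.-homog) -> p \is d.-homog -> msubst h p \is d.-homog.
Proof.
move=> h1 pd; rewrite [p]mpolyE rmorph_sum big_seq; apply: rpred_sum => m mp /=.
rewrite msubstZ; apply: dhomogZ; rewrite /msubst mmapX /mmap1.
have /eqP <- : mdeg m == d by apply/eqP/(dhomog_mf pd mp).
rewrite mdegE; apply: dhomog_prodr => i _.
by have := dhomogMn (m i) (h1 i); rewrite mul1n.
Qed.

Lemma pihomog_msubst n k (h : 'I_n -> {mpoly K[k]}) d p :
  (forall i, h i \is 1.-homog) ->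
  pihomog mdeg d (msubst h p) = msubst h (pihomog mdeg d p).
Proof.
move=> h1; have [s les] : exists s, (maxn d.+1 (msize p) <= s)%N by eexists.
have ds : (d < s)%N := leq_trans (leq_maxl _ _) les.
rewrite {1}(pihomog_partitionE (leq_trans (leq_maxr _ _) les)) rmorph_sum linear_sum.
rewrite (bigD1 (Ordinal ds)) //= big1 ?addr0.
  by apply: pihomog_dE; apply: msubst_homog => //; apply: pihomogP.
move=> e; rewrite -val_eqE /= => ne; apply: pihomog_ne0 ne _.
by apply: msubst_homog => //; apply: pihomogP.
Qed.

Lemma pihomogM n d e (G p : {mpoly K[n]}) : G \is e.-homog ->
  pihomog mdeg (e + d) (G * p) = G * pihomog mdeg d p.
Proof.
move=> Ge; have [s les] : exists s, (maxn d.+1 (msize p) <= s)%N by eexists.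
have ds : (d < s)%N := leq_trans (leq_maxl _ _) les.
rewrite {1}(pihomog_partitionE (leq_trans (leq_maxr _ _) les)) mulr_sumr linear_sum.
rewrite (bigD1 (Ordinal ds)) //= big1 ?addr0.
  by apply: pihomog_dE; apply: dhomogM => //; apply: pihomogP.
move=> k; rewrite -val_eqE /= => ne; apply: (@pihomog_ne0 _ _ _ (e + k)).
  by rewrite eqn_add2l.
by apply: dhomogM => //; apply: pihomogP.
Qed.

(** Homogeneous component, as an element of the finite-dimensional space of
    forms. It is total and linear, so that ideals can be cut down to one
    degree without homogeneity hypotheses on their elements. *)
Definition hproj n d (p : {mpoly K[n]}) : dhomog n K d := DHomog (pihomogP mdeg d p).

Lemma hproj_is_linear n d : linear (@hproj n d).
Proof. by move=> c p q; apply: val_inj; rewrite /= linearP. Qed.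

HB.instance Definition _ n d :=
  GRing.isLinear.Build K {mpoly K[n]} (dhomog n K d) *:%R (@hproj n d)
    (@hproj_is_linear n d).

Lemma val_hproj n d (p : {mpoly K[n]}) :
  p \is d.-homog -> mpoly_of_dhomog (hproj d p) = p.
Proof. exact: pihomog_dE. Qed.

Lemma hprojK n d (p : dhomog n K d) : hproj d (mpoly_of_dhomog p) = p.
Proof. by apply: val_inj; apply: val_hproj; case: p. Qed.

Lemma hproj_ne0 n d e (p : {mpoly K[n]}) : d != e -> p \is d.-homog -> hproj e p = 0.
Proof. by move=> de pd; apply: val_inj => /=; rewrite (pihomog_ne0 de pd). Qed.

(** The degree [d] part of the ideal generated by the [P a], when these are
    homogeneous. Only finitely many multiples matter, which exhibits it as a
    span over a finite family depending polynomially on the [P a]. *)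
Definition ideal_part n d (A : finType) (P : A -> {mpoly K[n.+1]}) :
    {vspace dhomog n.+1 K d} :=
  <<[seq hproj d (P x.1 * 'X_[x.2 : 'X_{1..n.+1 < d.+1}]) | x : A * 'X_{1..n.+1 < d.+1}]>>%VS.

Lemma hproj_mulX_gt n d (p : {mpoly K[n]}) m : (d < mdeg m)%N -> hproj d (p * 'X_[m]) = 0.
Proof.
move=> dm; rewrite [p]mpolyE mulr_suml linear_sum; apply: big1 => k _.
rewrite -scalerAl linearZ /= -mpolyXD (@hproj_ne0 _ (mdeg (k + m))) ?scaler0 ?dhomogX //.
by rewrite mdegD; lia.
Qed.

Lemma mem_ideal_part n d (A : finType) (P : A -> {mpoly K[n.+1]}) a H :
  hproj d (P a * H) \in ideal_part d P.
Proof.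
rewrite [H]mpolyE mulr_sumr linear_sum; apply: memv_suml => m _.
rewrite -scalerAr linearZ /=; apply: memvZ.
have [md|] := ltnP (mdeg m) d.+1; last first.
  by move=> dm; rewrite hproj_mulX_gt ?mem0v.
apply: memv_span; apply/mapP; exists (a, BMultinom md) => //=.
by rewrite mem_enum.
Qed.

Lemma ideal_part_subv n d (A : finType) (P : A -> {mpoly K[n.+1]}) (U : {vspace _}) :
  (forall a H, hproj d (P a * H) \in U) -> (ideal_part d P <= U)%VS.
Proof. by move=> PU; apply/span_subvP => _ /mapP[x _ ->]. Qed.

Lemma ideal_part_subset n d (A B : finType) (P : A -> {mpoly K[n.+1]})
    (Q : B -> {mpoly K[n.+1]}) :
  (forall a, exists b H, P a = Q b * H) -> (ideal_part d P <= ideal_part d Q)%VS.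
Proof.
move=> PQ; apply: ideal_part_subv => a H; have [b [H' ->]] := PQ a.
by rewrite -mulrA; apply: mem_ideal_part.
Qed.

Lemma dim_ideal_part_semicontinuous n M (A : finType) (P : A -> ('I_M -> K) -> {mpoly K[n.+1]}) dP d v0 :
  (forall a, polymap (P a) (dP a)) ->
  exists2 q : {mpoly K[M]}, q != 0 & forall v, q.@[v] != 0 ->
    (\dim (ideal_part d (fun a => P a v0)) <= \dim (ideal_part d (fun a => P a v)))%N.
Proof.
move=> PP.
apply: (dim_span_semicontinuous v0
  (w := fun (x : A * 'X_{1..n.+1 < d.+1}) v => hproj d (P x.1 v * 'X_[x.2]))) => x.
by apply: polymap_linear; apply: polymapM (PP _) (polymap_const _).
Qed.

(** * Ideals and their restrictions to a hyperplane *)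

(** The restriction [T -> S] to the hyperplane on which the last variable
    vanishes. *)
Definition mres n : {mpoly K[n.+1]} -> {mpoly K[n]} := mfix ord_max 0.

HB.instance Definition _ n := GRing.RMorphism.on (@mres n).

Definition mlift n : {mpoly K[n]} -> {mpoly K[n.+1]} :=
  msubst (fun i => 'X_(lift ord_max i)).

Lemma mliftK n : cancel (@mlift n) (@mres n).
Proof.
move=> p; elim/mpoly_ring_ind: p => [c|i|p q|p q].
- by rewrite /mlift /mres /mfix !msubstC.
- by rewrite /mlift /mres /mfix !msubstX liftK.
- by move=> Ep Eq; rewrite /mlift !rmorphD /= -!/(mlift _) Ep Eq.
- by move=> Ep Eq; rewrite /mlift !rmorphM /= -!/(mlift _) Ep Eq.
Qed.

Lemma homogX1 n (i : 'I_n) : ('X_i : {mpoly K[n]}) \is 1.-homog.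
Proof. by rewrite dhomogX; apply/eqP/mdeg1. Qed.

Lemma mlift_homog n d (p : {mpoly K[n]}) : p \is d.-homog -> mlift p \is d.-homog.
Proof. by apply: msubst_homog => i; apply: homogX1. Qed.

Lemma mres_vars_homog n (i : 'I_n.+1) :
  (if unlift ord_max i is Some i' then 'X_i' else 0%:MP : {mpoly K[n]}) \is 1.-homog.
Proof. by case: unlift => [i'|]; [apply: homogX1|rewrite mpolyC0 dhomog0]. Qed.

Lemma mres_homog n d (p : {mpoly K[n.+1]}) : p \is d.-homog -> mres p \is d.-homog.
Proof. by apply: msubst_homog => i; apply: mres_vars_homog. Qed.

Lemma hproj_mres n d (p : {mpoly K[n.+1]}) :
  hproj d (mres p) = hproj d (mres (mpoly_of_dhomog (hproj d p))).
Proof.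
apply: val_inj => /=; rewrite [LHS]pihomog_msubst; last exact: mres_vars_homog.
rewrite [RHS]pihomog_dE //; apply: mres_homog; exact: pihomogP.
Qed.

(** The kernel of the restriction [T_(d+1) -> S_(d+1)] contains the last
    variable times the degree [d] part of the ideal. *)
Lemma dim_ideal_part_mres n d (A : finType) (P : A -> {mpoly K[n.+2]}) :
  (\dim (ideal_part d.+1 (fun a => mres (P a))) + \dim (ideal_part d P) <=
   \dim (ideal_part d.+1 P))%N.
Proof.
pose res (p : dhomog n.+2 K d.+1) : dhomog n.+1 K d.+1 := hproj d.+1 (mres (mpoly_of_dhomog p)).
have res_lin : linear res.
  by move=> c p q; rewrite /res linearP rmorphD /= /mres /mfix msubstZ linearP.
pose muly (p : dhomog n.+2 K d) : dhomog n.+2 K d.+1 := hproj d.+1 ('X_ord_max * mpoly_of_dhomog p).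
have muly_lin : linear muly.
  by move=> c p q; rewrite /muly linearP mulrDr -scalerAr linearP.
pose R : {linear _ -> _} := HB.pack res (GRing.isLinear.Build _ _ _ _ res res_lin).
pose Y : {linear _ -> _} := HB.pack muly (GRing.isLinear.Build _ _ _ _ muly muly_lin).
have resE x : linfun R x = res x by rewrite lfunE.
have mulyE x : linfun Y x = muly x by rewrite lfunE.
have valY x : mpoly_of_dhomog (muly x) = 'X_ord_max * mpoly_of_dhomog x.
  by apply: val_hproj; apply: (@dhomogM _ _ _ 1); [apply: homogX1|case: x].
rewrite -(limg_ker_dim (linfun R)) addnC; apply: leq_add; last first.
  apply: dimvS; apply: ideal_part_subv => a H.
  have -> : hproj d.+1 (mres (P a) * H) = linfun R (hproj d.+1 (P a * mlift H)).
    by rewrite resE /res -hproj_mres rmorphM /= mliftK.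
  by apply: memv_img; apply: mem_ideal_part.
have <- : \dim (linfun Y @: ideal_part d P) = \dim (ideal_part d P).
  apply: limg_dim_eq; apply/eqP; rewrite -subv0; apply/subvP => x.
  rewrite memv_cap memv_ker mulyE memv0 => /andP[_ /eqP/(congr1 (@mpoly_of_dhomog _ _ _))].
  rewrite valY => /eqP; rewrite mulf_eq0 => /orP[/eqP X0|/eqP x0].
    by have /eqP := mcoeffX K U_(ord_max : 'I_n.+2) U_(ord_max); rewrite X0 mcoeff0 eqxx eq_sym oner_eq0.
  by apply/eqP; apply: val_inj.
apply: dimvS; rewrite subv_cap; apply/andP; split; last first.
  apply/subvP => _ /memv_imgP[x xP ->].
  rewrite memv_ker resE mulyE /res valY rmorphM /= /mres /mfix msubstX unlift_none.
  by rewrite mpolyC0 mul0r linear0.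
rewrite limg_span; apply/span_subvP => _ /mapP[_ /mapP[x _ ->] ->].
have -> : linfun Y (hproj d (P x.1 * 'X_[x.2])) = hproj d.+1 (P x.1 * ('X_ord_max * 'X_[x.2])).
  rewrite mulyE; apply: val_inj; rewrite [LHS]valY /= [in RHS]mulrCA.
  exact: (esym (pihomogM d _ (homogX1 _))).
exact: mem_ideal_part.
Qed.

End GradedPieces.

(** * Tangent spaces to the secant variety *)

(** Each new summand meets the sum of the previous ones at least in the line
    of [w]. *)
Lemma dim_sum_common (K : fieldType) (V : vectType K) (I : Type) (s : seq I)
    (U : I -> {vspace V}) w : w != 0 -> (forall i, w \in U i) ->
  (\dim (\sum_(i <- s) U i) + (size s).-1 <= \sum_(i <- s) \dim (U i))%N.
Proof.
move=> w0 wU; case: s => [|i s]; first by rewrite !big_nil dimv0.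
elim: s i => [|j s IHs] i; first by rewrite !big_seq1 addn0.
rewrite [X in (\dim X + _)%N]big_cons [leqRHS]big_cons.
have capP : (0 < \dim (U i :&: \sum_(k <- j :: s) U k))%N.
  rewrite lt0n dimv_eq0; apply: contraNneq w0 => cap0.
  by rewrite -memv0 -cap0 memv_cap wU big_cons; apply/memv_addP; exists w; rewrite ?wU //; exists 0; rewrite ?mem0v ?addr0.
have := dimv_sum_cap (U i) (\sum_(k <- j :: s) U k).
move: (IHs j) capP => /=.
by move: (\dim (_ + _)) (\dim (_ :&: _)) (\dim (\sum_(_ <- _) _)) => a b c; lia.
Qed.

Section Tangent.
Context {K : fieldType} {l r : nat} (dd : 'I_r -> nat).
Local Notation d := (\sum_j dd j)%N.
Local Notation tuples n := ('I_l -> 'I_r -> {mpoly K[n]}).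

Definition forms_of n (F : tuples n) := forall i j, F i j \is (dd j).-homog.

(** The derivative of [\prod_j F i j] in the direction of the [j]-th factor is
    multiplication by this product. *)
Definition cofactor n (F : tuples n) i j : {mpoly K[n]} := \prod_(j' | j' != j) F i j'.

Lemma mul_cofactor n (F : tuples n) i j : cofactor F i j * F i j = \prod_j' F i j'.
Proof. by rewrite mulrC [RHS](bigD1 j). Qed.

Lemma prod_homog n (F : tuples n) i : forms_of F -> \prod_j F i j \is d.-homog.
Proof. by move=> Fh; apply: dhomog_prodr. Qed.

Lemma cofactor_homog n (F : tuples n) i j : forms_of F ->
  cofactor F i j \is (\sum_(j' | j' != j) dd j')%N.-homog.
Proof. by move=> Fh; apply: dhomog_prodr. Qed.

(** Generators of the ideal [J_0 + ... + J_(k-1)], where [J_i] is generated by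
    the cofactors of the [i]-th tuple; the family is padded with zeros to keep
    its index type independent of [k]. Below, [prod_gens] does the same for
    the product of this ideal and [J_k]. *)
Definition sum_gens n (F : tuples n) (k : nat) (x : 'I_l * 'I_r) : {mpoly K[n]} :=
  if (x.1 < k)%N then cofactor F x.1 x.2 else 0.

Definition prod_gens n (F : tuples n) (k : 'I_l) (x : 'I_l * 'I_r * 'I_r) : {mpoly K[n]} :=
  sum_gens F k x.1 * cofactor F k x.2.

(** The intersection of two ideals contains their product. *)
Lemma dim_sum_gens_step n (F : tuples n.+1) (k : 'I_l) e :
  (\dim (ideal_part e (sum_gens F k.+1)) + \dim (ideal_part e (prod_gens F k)) <=
   \dim (ideal_part e (sum_gens F k)) + \dim (ideal_part e (cofactor F k)))%N.
Proof.
rewrite -[leqRHS]dimv_sum_cap; apply: leq_add; apply: dimvS.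
  apply: ideal_part_subv => -[i j] H; rewrite /sum_gens /= ltnS leq_eqVlt.
  case: eqP => [/val_inj -> | _] /=.
    by apply: subvP (addvSr _ _) _ _; apply: mem_ideal_part.
  apply: subvP (addvSl _ _) _ _.
  exact: (mem_ideal_part e (sum_gens F k) (i, j)).
rewrite subv_cap; apply/andP; split; apply: ideal_part_subset => -[x j].
  by exists x, (cofactor F k j).
by exists j, (sum_gens F k x); rewrite mulrC.
Qed.

(** The [j]-th cofactor contributes at most the dimension of the forms of
    degree [dd j], and the [r] contributions all contain the product of the [F
    i j]. *)
Lemma dim_cofactors n (F : tuples n.+1) i : forms_of F -> \prod_j F i j != 0 ->
  (\dim (ideal_part d (cofactor F i)) + r.-1 <= \sum_j 'C(dd j + n, n))%N.
Proof.
move=> Fh F0; pose U j := ideal_part d (fun _ : unit => cofactor F i j).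
have dimU j : (\dim (U j) <= 'C(dd j + n, n))%N.
  pose mul (H : dhomog n.+1 K (dd j)) : dhomog n.+1 K d :=
    hproj d (cofactor F i j * mpoly_of_dhomog H).
  have mul_lin : linear mul by move=> c p q; rewrite /mul linearP mulrDr -scalerAr linearP.
  pose L : {linear _ -> _} := HB.pack mul (GRing.isLinear.Build _ _ _ _ mul mul_lin).
  have -> : 'C(dd j + n, n) = \dim {: dhomog n.+1 K (dd j)}.
    by rewrite dimvf /= -bin_sub ?leq_addl // addnK.
  apply: leq_trans (dimvS _) (_ : \dim (limg (linfun L)) <= _)%N; last first.
    by rewrite -(limg_ker_dim (linfun L) fullv) leq_addl.
  apply: ideal_part_subv => -[] H.
  suff -> : hproj d (cofactor F i j * H) = linfun L (hproj (dd j) H) by apply/memv_img/memvf.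
  rewrite lfunE /= /mul; apply: val_inj => /=.
  have dE : d = ((\sum_(j' | j' != j) dd j') + dd j)%N by rewrite (bigD1 j) //= addnC.
  by rewrite dE !(pihomogM _ _ (cofactor_homog i j Fh)) pihomog_id.
pose w := hproj d (\prod_j F i j).
have w0 : w != 0.
  apply: contra_neq F0 => /(congr1 (@mpoly_of_dhomog _ _ _)).
  by rewrite val_hproj ?prod_homog.
have wU j : w \in U j by rewrite /w -(mul_cofactor F i j); apply: mem_ideal_part tt _.
apply: (@leq_trans (\sum_j \dim (U j))); last by apply: leq_sum => j _; apply: dimU.
have := dim_sum_common (index_enum 'I_r) w0 wU.
have -> : size (index_enum 'I_r) = r by rewrite -[RHS]card_ord -sum1_card -sum1_size.
apply: leq_trans; rewrite leq_add2r; apply: dimvS.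
apply: ideal_part_subv => j H; apply: subvP (sumv_sup j _ (subvv _)) _ _ => //.
exact: mem_ideal_part tt _.
Qed.

Lemma dim_sum_gens n (F : tuples n.+1) : forms_of F -> (forall i, \prod_j F i j != 0) ->
  (\dim (ideal_part d (sum_gens F l)) + \sum_k \dim (ideal_part d (prod_gens F k))
    + l * r.-1 <= l * \sum_j 'C(dd j + n, n))%N.
Proof.
move=> Fh F0.
suff : forall k, (k <= l)%N ->
  (\dim (ideal_part d (sum_gens F k)) + \sum_(i < l | (i < k)%N) \dim (ideal_part d (prod_gens F i))
    + k * r.-1 <= k * \sum_j 'C(dd j + n, n))%N.
  move=> /(_ l (leqnn l)); rewrite [X in (_ + X + _)%N](eq_bigl predT) // => i.
  by rewrite ltn_ord.
elim=> [|k IHk] lekl.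
  rewrite [X in (_ + X + _)%N]big_pred0 // !mul0n !addn0 leqn0 dimv_eq0 -subv0.
  apply: ideal_part_subv => x H; rewrite /sum_gens ltn0 mul0r linear0.
  exact: mem0v.
rewrite (bigD1 (Ordinal lekl)) //=.
rewrite (eq_bigl (fun i : 'I_l => (i < k)%N)); last first.
  by move=> i; rewrite -val_eqE /= ltnS; lia.
have := dim_sum_gens_step F (Ordinal lekl) d.
have := dim_cofactors Fh (F0 (Ordinal lekl)); have := IHk (ltnW lekl).
rewrite /= !mulSn.
set x1 := \dim _; set x2 := (\sum_(i < l | _) _)%N; set x3 := \dim _; set x4 := \dim _.
set x5 := \dim _; set x6 := (\sum_j 'C(_, _))%N.
move: x1 x2 x3 x4 x5 x6 => x1 x2 x3 x4 x5 x6.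
by move: (k * r.-1)%N (k * x6)%N (r.-1) => y1 y2 y3; lia.
Qed.

End Tangent.

(** * Generic tuples of forms *)

Section GenericTuples.
Context {K : fieldType} {l r : nat} (dd : 'I_r -> nat).
Local Notation d := (\sum_j dd j)%N.
Local Notation tuples n := ('I_l -> 'I_r -> {mpoly K[n]}).
Local Notation param n := ('I_l * 'I_r * 'X_{1..n < d.+1})%type.

(** The tuple of forms with coefficients [v], where the degree [dd j] is
    imposed by the choice of monomials. *)
Definition gform n (v : 'I_#|{: param n}| -> K) : tuples n := fun i j =>
  \sum_(m : 'X_{1..n < d.+1} | mdeg m == dd j) v (enum_rank (i, j, m)) *: 'X_[m].

Lemma gform_homog n (v : 'I_#|{: param n}| -> K) : forms_of dd (gform v).
Proof. by move=> i j; apply: rpred_sum => m mj; apply: dhomogZ; rewrite dhomogX. Qed.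

Lemma gform_surj n (F : tuples n) : forms_of dd F ->
  exists v, forall i j, gform v i j = F i j.
Proof.
move=> Fh; exists (fun x : 'I_#|{: param n}| => let: (i, j, m) := enum_val x in (F i j)@_m) => i j.
rewrite /gform (eq_bigr (fun m : 'X_{1..n < d.+1} => (F i j)@_m *: 'X_[m])); last first.
  by move=> m _; rewrite enum_rankK.
rewrite -[RHS](pihomog_dE (Fh i j)) (@pihomogwE _ _ _ _ d.+1) //.
have [->|F0] := eqVneq (F i j) 0; first by rewrite msize0.
rewrite -mlead_deg // (dhomog_mf (Fh i j) (mlead_supp F0)).
by rewrite ltnS (bigD1 j) //= leq_addr.
Qed.

Lemma polymap_gform n i j :
  polymap (fun v => @gform n v i j) (fun _ u => @gform n u i j).
Proof. by apply: polymap_sum => m; apply: polymap_coord. Qed.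

Definition polynomial_map M (W : lmodType K) (w : ('I_M -> K) -> W) :=
  exists dw, polymap w dw.

Lemma polynomial_cofactor n i j :
  polynomial_map (fun v => cofactor (@gform n v) i j).
Proof. by eexists; apply: polymap_prod => j'; apply: polymap_gform. Qed.

Lemma polynomial_sum_gens n k x :
  polynomial_map (fun v => sum_gens (@gform n v) k x).
Proof.
rewrite /sum_gens; case: ltnP => _; first exact: polynomial_cofactor.
by eexists; apply: polymap_const.
Qed.

Lemma polynomial_prod_gens n k x :
  polynomial_map (fun v => prod_gens (@gform n v) k x).
Proof.
have [d1 P1] := polynomial_sum_gens n k x.1.
have [d2 P2] := polynomial_cofactor n k x.2.
by eexists; apply: polymapM P1 P2.
Qed.

Lemma dim_ideal_part_generic M n (A : finType) (P : A -> ('I_M -> K) -> {mpoly K[n.+1]}) e v0 :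
  (forall a, polynomial_map (P a)) ->
  exists2 q : {mpoly K[M]}, q != 0 & forall v, q.@[v] != 0 ->
    (\dim (ideal_part e (fun a => P a v0)) <= \dim (ideal_part e (fun a => P a v)))%N.
Proof.
move=> PP; have [dP dPP] := fin_all_exists PP.
exact: dim_ideal_part_semicontinuous dPP.
Qed.

Lemma eq_ideal_part n e (A : finType) (P Q : A -> {mpoly K[n.+1]}) :
  P =1 Q -> ideal_part e P = ideal_part e Q.
Proof.
move=> PQ; apply/eqP; rewrite eqEsubv; apply/andP.
by split; apply: ideal_part_subset => a; exists a, 1; rewrite mulr1 PQ.
Qed.

Lemma mres_cofactor n (F : tuples n.+1) i j :
  mres (cofactor F i j) = cofactor (fun i j => mres (F i j)) i j.
Proof. exact: rmorph_prod. Qed.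

Lemma eq_cofactor n (F G : tuples n) i j : (forall j, F i j = G i j) ->
  cofactor F i j = cofactor G i j.
Proof. by move=> FG; apply: eq_bigr => j' _. Qed.

Lemma eq_sum_gens n (F G : tuples n) k x : (forall i j, F i j = G i j) ->
  sum_gens F k x = sum_gens G k x.
Proof. by move=> FG; rewrite /sum_gens (@eq_cofactor _ F G). Qed.

Lemma mres_sum_gens n (F : tuples n.+1) k x :
  mres (sum_gens F k x) = sum_gens (fun i j => mres (F i j)) k x.
Proof. by rewrite /sum_gens; case: ifP => _; rewrite ?mres_cofactor ?rmorph0. Qed.

Lemma polynomial_mres M n (w : ('I_M -> K) -> {mpoly K[n.+1]}) :
  polynomial_map w -> polynomial_map (fun v => mres (w v)).
Proof.
move=> [dw wP]; have mres_lin : linear (@mres K n).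
  by move=> c p q; rewrite rmorphD /= /mres /mfix msubstZ.
pose L : {linear _ -> _} := HB.pack (@mres K n) (GRing.isLinear.Build _ _ _ _ (@mres K n) mres_lin).
by eexists; apply: (polymap_linear L wP).
Qed.

Hypothesis charK : [pchar K] =i pred0.

(** The tuple [F0] over [S] is the restriction of a tuple over [T]. The
    dimension for [F0], and the dimensions for [E] of the ideals whose
    dimensions enter with a minus sign, are bounded by the corresponding
    dimensions for a generic tuple over [T] and for its restriction. *)
Lemma dim_tangent_leq n e (F0 : tuples n.+1) (E : tuples n.+2) :
  d = e.+1 -> forms_of dd F0 -> forms_of dd E -> (forall i, \prod_j E i j != 0) ->
  (\dim (ideal_part d (sum_gens F0 l)) + \dim (ideal_part e (sum_gens E l)) +
   \sum_k \dim (ideal_part d (prod_gens E k)) + l * r.-1 <=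
   l * \sum_j 'C(dd j + n.+1, n.+1))%N.
Proof.
move=> de F0h Eh E0.
have [v0 v0E] : exists v0, forall i j, @gform n.+2 v0 i j = mlift (F0 i j).
  by apply: gform_surj => i j; apply: mlift_homog.
have [vE vEE] := gform_surj Eh.
have [q1 q1n q1P] := @dim_ideal_part_generic _ n _
  (fun x v => mres (sum_gens (@gform n.+2 v) l x)) d v0
  (fun x => polynomial_mres (polynomial_sum_gens _ _ x)).
have [q2 q2n q2P] := @dim_ideal_part_generic _ n.+1 _
  (fun x v => sum_gens (@gform n.+2 v) l x) e vE (polynomial_sum_gens _ _).
have [q3 q3n q3P] := fin_all_exists2 (fun k => @dim_ideal_part_generic _ n.+1 _
  (fun x v => prod_gens (@gform n.+2 v) k x) d vE (polynomial_prod_gens _ _)).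
have prodE i : exists2 q : {mpoly K[_]}, q != 0 &
    forall v, q.@[v] != 0 -> \prod_j @gform n.+2 v i j != 0.
  have [m mE] : exists m, (\prod_j E i j)@_m != 0.
    by exists (mlead (\prod_j E i j)); rewrite mleadc_eq0 E0.
  have [p [pE _]] := polymap_functional (mcoeff m)
    (polymap_prod xpredT (fun j => polymap_gform n.+2 i j)).
  exists p => [|v]; last by rewrite pE; apply: contraNneq => ->; rewrite linear0.
  apply: contraNneq mE => p0; have := pE vE; rewrite p0 meval0 => ->.
  by apply/eqP; congr _@_m; apply: eq_bigr => j _; rewrite vEE.
have [q4 q4n q4P] := fin_all_exists2 prodE.
have q0 : q1 * q2 * (\prod_k q3 k) * (\prod_i q4 i) != 0.
  by rewrite !mulf_neq0 //; apply/prodf_neq0 => i _.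
have [v] := exists_meval_neq0 charK q0.
rewrite !mevalM !rmorph_prod /= !mulf_eq0 !negb_or => /andP[/andP[/andP[v1 v2] v3] v4].
have {v3}q3v k : (\dim (ideal_part d (prod_gens E k)) <=
    \dim (ideal_part d (prod_gens (gform v) k)))%N.
  have -> : ideal_part d (prod_gens E k) = ideal_part d (prod_gens (gform vE) k).
    apply: eq_ideal_part => x; rewrite /prod_gens; congr (_ * _).
      by apply: eq_sum_gens => i j; rewrite vEE.
    by apply: eq_cofactor => j; rewrite vEE.
  by apply: q3P; move/prodf_neq0: v3; apply.
have {v4}G0 i : \prod_j gform v i j != 0.
  by apply: q4P; move/prodf_neq0: v4; apply.
have {q1P v1}q1v := q1P v v1; have {q2P v2}q2v := q2P v v2.
have := dim_sum_gens (@gform_homog _ v) G0.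
have := dim_ideal_part_mres e (sum_gens (gform v) l); rewrite -de.
have -> : ideal_part d (sum_gens F0 l) = ideal_part d (fun x => mres (sum_gens (gform v0) l x)).
  apply: eq_ideal_part => x; rewrite mres_sum_gens; apply: eq_sum_gens => i j.
  by rewrite v0E mliftK.
have -> : ideal_part e (sum_gens E l) = ideal_part e (sum_gens (gform vE) l).
  by apply: eq_ideal_part => x; apply: eq_sum_gens => i j; rewrite vEE.
have : (\sum_k \dim (ideal_part d (prod_gens E k)) <=
    \sum_k \dim (ideal_part d (prod_gens (gform v) k)))%N by apply: leq_sum => k _.
move: q1v q2v; set x1 := \dim _; set x2 := \dim _; set x3 := \dim _; set x4 := \dim _; set y1 := (\sum_k \dim _)%N; set y2 := (\sum_k \dim _)%N.
set x5 := \dim _; set z := (\sum_j 'C(_, _))%N.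
move: (l * r.-1)%N (l * z)%N x1 x2 x3 x4 x5 y1 y2; lia.
Qed.

End GenericTuples.

(** * Leading degrees of binary forms *)

Section LeadingDegrees.
Context {K : fieldType} (charK : [pchar K] =i pred0) {r : nat} (dd : 'I_r -> nat).
Local Notation d := (\sum_j dd j)%N.

(** The linear forms used in the special tuple, dehomogenized; their roots are
    distinct because the characteristic is zero. *)
Definition ulin (j : 'I_r) : {poly K} := 'X - ((j : nat)%:R)%:P.

Definition ucofactor (j : 'I_r) : {poly K} := \prod_(j' | j' != j) ulin j' ^+ dd j'.

(** Dehomogenized degree [m] part of the ideal generated by the cofactors in
    two variables: the [j]-th cofactor has degree [d - dd j], and is
    multiplied by a form of degree [m - (d - dd j)] if this is not negative.
    *)
Definition upart m (p : {poly K}) := exists2 a : 'I_r -> {poly K},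
  (forall j, size (a j) <= m.+1 - (d - dd j))%N & p = \sum_j a j * ucofactor j.

Lemma leq_dd j : (dd j <= d)%N.
Proof. by rewrite (bigD1 j) //= leq_addr. Qed.

Lemma size_ucofactor j : size (ucofactor j) = (d - dd j).+1.
Proof.
rewrite size_prod => [|i _]; last by rewrite expf_neq0 // polyXsubC_eq0.
rewrite (eq_bigr (fun i => dd i + 1)%N) => [|i _]; last first.
  by rewrite size_exp_XsubC addn1.
rewrite big_split /= sum1_card [in RHS](bigD1 j) //= addKn.
by move: (\sum_(i | i != j) dd i)%N #|_| => x y; lia.
Qed.

Lemma size_upart m p : upart m p -> (size p <= m.+1)%N.
Proof.
case=> a aP ->; apply: leq_trans (size_sum _ _ _) _; apply/bigmax_leqP => j _.
have [->|a0] := eqVneq (a j) 0; first by rewrite mul0r size_poly0.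
apply: leq_trans (size_polyMleq _ _) _; rewrite size_ucofactor addnS /=.
have := aP j; have : (0 < size (a j))%N by rewrite size_poly_gt0.
by move: (d - dd j)%N (size (a j)) => x y; lia.
Qed.

Lemma coprimep_ulin i j : i != j -> coprimep (ulin i) (ulin j).
Proof.
move=> ij; rewrite coprimep_XsubC root_XsubC.
by apply: contra_neq ij => /(pchar0_natr_inj charK)/val_inj.
Qed.

(** The [j]-th power [ulin j ^+ dd j] divides all cofactors but the [j]-th, to
    which it is coprime; hence it divides [a j], whose degree is smaller. *)
Lemma ucofactor_independent (a : 'I_r -> {poly K}) :
  (forall j, size (a j) <= dd j)%N -> \sum_j a j * ucofactor j = 0 ->
  forall j, a j = 0.
Proof.
move=> sza a0 j; apply/eqP/negPn/negP => aj0.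
have dvd_a : ulin j ^+ dd j %| a j.
  have <- : (ulin j ^+ dd j %| a j * ucofactor j) = (ulin j ^+ dd j %| a j).
    apply: Gauss_dvdpl.
    rewrite coprimep_expl //; apply: (big_ind (coprimep (ulin j))) => [|x y|i].
    - exact: coprimep1.
    - by move=> xP yP; rewrite coprimepMr xP yP.
    - by rewrite eq_sym => ij; apply/coprimep_expr/coprimep_ulin.
  move/eqP: a0; rewrite (bigD1 j) //= addr_eq0 => /eqP ->.
  rewrite dvdpNr; apply: (big_ind (fun q => ulin j ^+ dd j %| q)) => [|x y xP yP|i ij]; first exact: dvdp0.
    exact: dvdp_add.
  by rewrite dvdp_mull // /ucofactor (bigD1 j) ?dvdp_mulIl //= eq_sym.
have := dvdp_leq aj0 dvd_a; rewrite size_exp_XsubC.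
by rewrite ltnNge sza.
Qed.

Definition lead_degrees m : {set 'I_m.+1} :=
  [set k : 'I_m.+1 | `[< exists2 p, upart m p & size p = k.+1 >]].

(** If there were fewer leading degrees than independent generators, some
    nonzero combination of the generators would have zero coefficients in all
    leading degrees, and in particular in its own. *)
Lemma card_lead_degrees m : (m < d)%N ->
  (\sum_j (m.+1 - (d - dd j)) <= #|lead_degrees m|)%N.
Proof.
move=> md; rewrite leqNgt; apply/negP => lt_card.
pose I : finType := {j : 'I_r & 'I_(m.+1 - (d - dd j))}.
pose gen (x : I) : {poly K} := 'X^(tagged x) * ucofactor (tag x).
have cardI : #|I| = (\sum_j (m.+1 - (d - dd j)))%N.
  transitivity (\sum_j \sum_(k < m.+1 - (d - dd j)) 1)%N; last first.
    by apply: eq_bigr => j _; rewrite sum1_card card_ord.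
  rewrite -sum1_card (sig_big_dep xpredT (fun _ => xpredT) (fun _ _ => 1%N)).
  exact: eq_bigl.
pose J : finType := {k : 'I_m.+1 | k \in lead_degrees m}.
have [|u [x ux] Eu] := @exists_linear_relation K I J (fun x k => (gen x)`_(val k)).
  by rewrite cardI card_sig (eq_card (B := lead_degrees m)).
pose tg j (k : 'I_(m.+1 - (d - dd j))) : I := Tagged (fun j => 'I_(m.+1 - (d - dd j))) k.
pose a j := \poly_(k < m.+1 - (d - dd j))
  (if insub k is Some k' then u (tg j k') else 0).
pose p := \sum_j a j * ucofactor j.
have aE j : a j = \sum_(k < m.+1 - (d - dd j)) u (tg j k) *: 'X^k.
  by rewrite /a poly_def; apply: eq_bigr => k _; rewrite valK.
have pE : p = \sum_x u x *: gen x.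
  transitivity (\sum_j \sum_(k < m.+1 - (d - dd j)) u (tg j k) *: gen (tg j k)); last first.
    rewrite (sig_big_dep xpredT (fun _ => xpredT) (fun j k => u (tg j k) *: gen (tg j k))).
    by apply: eq_big => [x'|[j k] _].
  apply: eq_bigr => j _; rewrite aE mulr_suml; apply: eq_bigr => k _.
  by rewrite /gen /= scalerAl.
have szaj j : (size (a j) <= m.+1 - (d - dd j))%N by apply: size_poly.
have pU : upart m p by exists a.
have p0 : p != 0.
  apply: contraNneq ux => p0; case: x => j k.
  have /(congr1 (fun q : {poly K} => q`_k)) : a j = 0.
    apply: (ucofactor_independent _ p0 j) => i; apply: leq_trans (szaj i) _.
    by have := leq_dd i; move: d md (dd i) => D md x; lia.
  by rewrite coef0 coef_poly ltn_ord valK => ->.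
have szp : ((size p).-1 < m.+1)%N.
  by rewrite prednK ?size_poly_gt0 // size_upart.
have kD : Ordinal szp \in lead_degrees m.
  by rewrite inE; apply/asboolP; exists p => //=; rewrite prednK // size_poly_gt0.
have /= Ek := Eu (exist (fun k : 'I_m.+1 => is_true (k \in lead_degrees m)) (Ordinal szp) kD).
have : lead_coef p == 0.
  rewrite lead_coefE {1}pE coef_sum -[X in _ == X]Ek; apply/eqP.
  by apply: eq_bigr => y _; rewrite coefZ.
by rewrite lead_coef_eq0 (negPf p0).
Qed.

Lemma upartX m p : upart m p -> upart m.+1 ('X * p).
Proof.
case=> a aP ->; exists (fun j => 'X * a j) => [j|].
  have [->|a0] := eqVneq (a j) 0; first by rewrite mulr0 size_poly0.
  rewrite mulrC size_mulX //; have := aP j.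
  have : (0 < size (a j))%N by rewrite size_poly_gt0.
  by move: (d - dd j)%N (size (a j)) => x y; lia.
by rewrite mulr_sumr; apply: eq_bigr => j _; rewrite mulrA.
Qed.

Lemma upart_widen m p : upart m p -> upart m.+1 p.
Proof. by case=> a aP ->; exists a => // j; apply: leq_trans (aP j) _; rewrite leq_sub2r. Qed.

(** In degree [d - 1] the lower bound for the number of leading degrees is
    [\sum_j dd j = d], so that all [d] possible ones occur. Degree [d]
    inherits them from degree [d - 1], the positive ones through
    multiplication by the variable. *)
Lemma lead_degrees_top m : (0 < d)%N -> (m.+1 = d \/ m = d)%N ->
  forall k, k \in lead_degrees m.
Proof.
have full m' (k : 'I_m'.+1) : m'.+1 = d -> exists2 p, upart m' p & size p = k.+1.
  move=> md; apply/asboolP; suff : k \in lead_degrees m' by rewrite inE.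
  suff cardE : #|lead_degrees m'| = #|'I_m'.+1| by rewrite (subset_cardP cardE (subset_predT _)).
  apply/eqP; rewrite eqn_leq max_card card_ord.
  apply: leq_trans (card_lead_degrees _); last by rewrite -md.
  rewrite (eq_bigr dd) -?md // => j _; have := leq_dd j.
  by rewrite -md; move: (dd j) => x; lia.
move=> d0 md k; rewrite inE; apply/asboolP.
case: md => [/full//|]; case: m k => [k E|m k md]; first by rewrite -E in d0.
case: (unliftP ord0 k) => [k' ->|->]; last first.
  have [p pU szp] := full m ord0 md.
  by exists p => //; apply: upart_widen.
have [p pU szp] := full m k' md; exists ('X * p); first exact: upartX.
by rewrite mulrC size_mulX -?size_poly_gt0 szp.
Qed.

End LeadingDegrees.

(** * Homogenization *)

Section Homogenization.
Context {K : fieldType} {n : nat} (x y : 'I_n).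

Implicit Types p q : {poly K}.

Definition homogenize e (p : {poly K}) : {mpoly K[n]} :=
  \sum_(k < e.+1) p`_k *: 'X_[U_(x) *+ k + U_(y) *+ (e - k)].

Lemma homogenize_homog e p : homogenize e p \is e.-homog.
Proof.
apply: rpred_sum => k _; apply: dhomogZ; rewrite dhomogX.
apply/eqP; rewrite /= mdegD !mdegMn !mdeg1 !mul1n subnKC //.
by rewrite -ltnS ltn_ord.
Qed.

Lemma homogenize0 e : homogenize e 0 = 0.
Proof. by apply: big1 => k _; rewrite coef0 scale0r. Qed.

Lemma homogenizeB e p q : homogenize e (p - q) = homogenize e p - homogenize e q.
Proof. by rewrite -sumrB; apply: eq_bigr => k _; rewrite coefB scalerBl. Qed.

Lemma homogenizeZ e c p : homogenize e (c *: p) = c *: homogenize e p.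
Proof. by rewrite scaler_sumr; apply: eq_bigr => k _; rewrite coefZ scalerA. Qed.

Lemma homogenize_sum e (I : Type) (s : seq I) (p : I -> {poly K}) :
  homogenize e (\sum_(i <- s) p i) = \sum_(i <- s) homogenize e (p i).
Proof.
rewrite exchange_big; apply: eq_bigr => k _.
by rewrite coef_sum scaler_suml.
Qed.

Lemma homogenizeX e p : homogenize e.+1 ('X * p) = 'X_x * homogenize e p.
Proof.
rewrite /homogenize big_ord_recl coefXM scale0r add0r mulr_sumr.
apply: eq_bigr => k _; rewrite coefXM /= -scalerAr -mpolyXD subSS.
by rewrite /bump /= add1n mulmS addmA.
Qed.

Lemma homogenizeY e p : (size p <= e.+1)%N -> homogenize e.+1 p = 'X_y * homogenize e p.
Proof.
move=> szp; rewrite /homogenize big_ord_recr /= [p`_e.+1]nth_default // scale0r addr0.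
rewrite mulr_sumr; apply: eq_bigr => k _.
rewrite -scalerAr -mpolyXD subSn; last by rewrite -ltnS.
congr (_ *: 'X_[_]); apply/mnmP => j; rewrite !mnmDE !mulmnE mulnS; lia.
Qed.

Definition hlin (c : K) : {mpoly K[n]} := 'X_x - c *: 'X_y.

Lemma homogenize_lin e c p : (size p <= e.+1)%N ->
  homogenize e.+1 (('X - c%:P) * p) = hlin c * homogenize e p.
Proof.
move=> szp; rewrite mulrBl homogenizeB homogenizeX mul_polyC homogenizeZ.
by rewrite homogenizeY // mulrBl scalerAl.
Qed.

(** Homogenization is multiplicative only as long as the prescribed degrees
    bound the actual ones, whence the hypothesis on [size p]. *)
Lemma homogenize_linX e c k p : (size p <= e.+1)%N ->
  homogenize (k + e) (('X - c%:P) ^+ k * p) = hlin c ^+ k * homogenize e p.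
Proof.
move=> szp; elim: k => [|k IHk]; first by rewrite !expr0 !mul1r.
rewrite !exprS -!mulrA addSn homogenize_lin ?IHk //.
have [->|p0] := eqVneq p 0; first by rewrite mulr0 size_poly0.
rewrite size_proper_mul; last first.
  by rewrite mulf_neq0 ?lead_coef_eq0 ?expf_neq0 ?polyXsubC_eq0.
by rewrite size_exp_XsubC addSn /= -addnS leq_add2l.
Qed.

Lemma homogenize_prod e (I : Type) (s : seq I) (c : I -> K) (k : I -> nat) p :
  (size p <= e.+1)%N ->
  homogenize (\sum_(i <- s) k i + e) (\prod_(i <- s) ('X - (c i)%:P) ^+ k i * p) =
  \prod_(i <- s) hlin (c i) ^+ k i * homogenize e p.
Proof.
move=> szp; suff [] : (size (\prod_(i <- s) ('X - (c i)%:P) ^+ k i * p)%R <=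
    (\sum_(i <- s) k i + e).+1)%N /\
  homogenize (\sum_(i <- s) k i + e) (\prod_(i <- s) ('X - (c i)%:P) ^+ k i * p) =
  \prod_(i <- s) hlin (c i) ^+ k i * homogenize e p by [].
elim: s => [|i s [IHsz IHs]]; first by rewrite !big_nil !mul1r.
rewrite !big_cons -!mulrA -addnA homogenize_linX // IHs; split=> //.
have [->|p0] := eqVneq (\prod_(i <- s) ('X - (c i)%:P) ^+ k i * p) 0.
  by rewrite mulr0 size_poly0.
apply: leq_trans (size_polyMleq _ _) _.
by rewrite size_exp_XsubC addSn /= -addnS leq_add2l.
Qed.

Hypothesis xy : (x < y)%N.

(** In the monomial order of [mlead] the earlier variable [x] is the larger
    one, so that among the monomials of degree [e] in [x] and [y] the leading
    one has the highest power of [x]. *)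
Lemma mlead_homogenize e p a : size p = a.+1 -> (a <= e)%N ->
  homogenize e p != 0 /\ mlead (homogenize e p) = (U_(x) *+ a + U_(y) *+ (e - a))%MM.
Proof.
move=> szp ae; pose mon k := (U_(x) *+ k + U_(y) *+ (e - k))%MM.
have nxy : (x == y) = false by apply/eqP => E; move: xy; rewrite E ltnn.
have monx k : mon k x = k.
  by rewrite mnmDE !mulmnE !mnm1E eqxx eq_sym nxy mul1n mul0n addn0.
have mdeg_mon k : (k <= e)%N -> mdeg (mon k) = e.
  by move=> ke; rewrite mdegD !mdegMn !mdeg1 !mul1n subnKC.
have mon_lt k1 k2 : (k1 < k2 <= e)%N -> (mon k1 < mon k2)%O.
  case/andP=> lt_k k2e; apply/ltmcP.
    by rewrite !mdeg_mon // ltnW // (leq_trans lt_k).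
  exists x; last by rewrite !monx.
  move=> j jx; rewrite !mnmDE !mulmnE !mnm1E.
  have -> : (x == j) = false by apply/eqP => E; rewrite E ltnn in jx.
  have -> : (y == j) = false; last by [].
  by apply/eqP => E; rewrite -E in jx; have := ltn_trans xy jx; rewrite ltnn.
have coefE m : (homogenize e p)@_m = \sum_(k < e.+1) p`_k * (mon k == m)%:R.
  by rewrite raddf_sum; apply: eq_bigr => k _; rewrite /= mcoeffZ mcoeffX.
have ltae : (a < e.+1)%N by [].
have lead_in : mon a \in msupp (homogenize e p).
  rewrite mcoeff_msupp coefE (bigD1 (Ordinal ltae)) //= eqxx mulr1 big1 ?addr0.
    by have : lead_coef p != 0; [rewrite lead_coef_eq0 -size_poly_gt0 szp|rewrite lead_coefE szp].
  move=> k nk; have -> : (mon k == mon a) = false; last by rewrite mulr0.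
  apply: contra_neqF nk => /eqP/(congr1 (fun m : 'X_{1..n} => m x)).
  by rewrite !monx => E; apply: val_inj.
have h0 : homogenize e p != 0.
  by apply: contraTneq lead_in => ->; rewrite msupp0.
split=> //; apply/eqP; rewrite Order.POrderTheory.eq_le [X in _ && X]msupp_le_mlead // andbT.
have := mlead_supp h0; rewrite mcoeff_msupp coefE => nz.
have [k _ knz] : exists2 k : 'I_e.+1, true & p`_k * (mon k == mlead (homogenize e p))%:R != 0.
  apply: contrapT => nk; case/eqP: nz; apply: big1 => k _.
  by apply/eqP/negPn/negP => knz; apply: nk; exists k.
move: knz; rewrite mulf_eq0 negb_or => /andP[pk].
case: (mon k =P _) => [<- _|_]; last by rewrite eqxx.
have ka : (k <= a)%N.
  by rewrite -ltnS -szp ltnNge; apply: contra pk => szk; rewrite nth_default.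
move: ka; rewrite leq_eqVlt => /orP[/eqP -> //|ka].
by apply: Order.POrderTheory.ltW; apply: mon_lt; rewrite ka.
Qed.

End Homogenization.

(** * A tuple of binary forms in separate variables *)

(** Forms with distinct leading monomials are independent: the largest leading
    monomial in a relation could not cancel. *)
Lemma dim_geq_leads (K : fieldType) n e (U : {vspace dhomog n.+1 K e}) (I : finType)
    (C : {pred I}) (mu : I -> 'X_{1..n.+1}) (w : I -> {mpoly K[n.+1]}) :
  injective mu ->
  (forall i, i \in C -> [/\ w i != 0, mlead (w i) = mu i, w i \is e.-homog &
     hproj e (w i) \in U]) ->
  (#|C| <= \dim U)%N.
Proof.
move=> mu_inj wP; rewrite leqNgt; apply/negP => lt_dim.
pose J : finType := {i : I | i \in C}.
have [|u [i0 ui0] Eu] := @exists_linear_relation K J 'I_(\dim U)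
    (fun i b => coord (vbasis U) b (hproj e (w (val i)))).
  by rewrite card_ord card_sig (eq_card (B := C)).
have wJ (i : J) := wP (val i) (valP i).
have sum0 : \sum_(i : J) u i *: w (val i) = 0.
  have : \sum_(i : J) u i *: hproj e (w (val i)) = 0.
    rewrite (eq_bigr (fun i : J => \sum_b
      (u i * coord (vbasis U) b (hproj e (w (val i)))) *: (vbasis U)`_b)).
      by rewrite exchange_big big1 // => b _; rewrite -scaler_suml Eu scale0r.
    move=> i _; have [_ _ _ iU] := wJ i.
    rewrite {1}(coord_vbasis iU) scaler_sumr.
    by apply: eq_bigr => b _; rewrite scalerA.
  move/(congr1 (@mpoly_of_dhomog _ _ _)); rewrite raddf_sum /= => E; rewrite -[RHS]E.
  apply: eq_bigr => i _; have [_ _ hi _] := wJ i.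
  by rewrite /= pihomog_dE.
case: (Order.TotalTheory.arg_maxP (P := fun i : J => u i != 0) (fun i : J => mu (val i)) ui0).
move=> i ui imax; case/eqP: ui.
have /(congr1 (mcoeff (mu (val i)))) := sum0.
rewrite mcoeff0 raddf_sum (bigD1 i) //= big1 ?addr0; last first.
  move=> j ji; rewrite mcoeffZ; have [->|uj] := eqVneq (u j) 0; first by rewrite mul0r.
  rewrite mcoeff_gt_mlead ?mulr0 //; have [_ -> _ _] := wJ j.
  have le_ji : (mu (val j) <= mu (val i))%O := imax j uj.
  rewrite Order.POrderTheory.lt_neqAle le_ji andbT.
  by rewrite (inj_eq mu_inj) (inj_eq val_inj).
have [wi <- _ _] := wJ i.
rewrite mcoeffZ => /eqP; rewrite mulf_eq0 mleadc_eq0 (negPf wi) orbF.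
by move/eqP.
Qed.

Section SpecialTuple.
Context {K : fieldType} (charK : [pchar K] =i pred0) {l r : nat} (dd : 'I_r -> nat).
Local Notation d := (\sum_j dd j)%N.
Context {n : nat} (n_eq : n.+2 = (2 * l)%N).

Fact xvar_subproof (i : 'I_l) : (2 * i < n.+2)%N.
Proof. by rewrite n_eq ltn_mul2l ltn_ord. Qed.

Fact yvar_subproof (i : 'I_l) : ((2 * i).+1 < n.+2)%N.
Proof. by rewrite n_eq; move: (ltn_ord i); move: (nat_of_ord i) => k; lia. Qed.

Definition xvar i : 'I_n.+2 := Ordinal (xvar_subproof i).
Definition yvar i : 'I_n.+2 := Ordinal (yvar_subproof i).

(** Forms in the variables [x_i, y_i] only, so that the leading monomials for
    different [i] multiply without collisions. *)
Definition special (i : 'I_l) (j : 'I_r) : {mpoly K[n.+2]} :=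
  hlin (xvar i) (yvar i) (j : nat)%:R ^+ dd j.

Lemma special_homog : forms_of dd special.
Proof.
move=> i j; rewrite -[dd j]mul1n; apply: dhomogMn.
by apply: rpredB; [|apply: dhomogZ]; apply: homogX1.
Qed.

Lemma special_neq0 i : \prod_j special i j != 0.
Proof.
apply/prodf_neq0 => j _; apply: expf_neq0.
apply: contraTneq isT => /(congr1 (mcoeff U_(xvar i))).
rewrite mcoeffB mcoeffZ !mcoeffXU eqxx mcoeff0.
have -> : (yvar i == xvar i) = false by apply/eqP => /(congr1 val) /=; lia.
by move/eqP; rewrite mulr0 subr0 oner_eq0.
Qed.

Definition in_cofactors i (q : {mpoly K[n.+2]}) :=
  exists H, q = \sum_j H j * cofactor special i j.

(** The dehomogenized ideal is the ideal of the special tuple restricted to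
    one pair of variables. *)
Lemma homogenize_upart i m p : upart dd m p ->
  in_cofactors i (homogenize (xvar i) (yvar i) m p).
Proof.
case=> a aP ->.
exists (fun j => homogenize (xvar i) (yvar i) (m - (d - dd j)) (a j)).
rewrite homogenize_sum; apply: eq_bigr => j _.
have [->|aj0] := eqVneq (a j) 0.
  by rewrite mul0r !homogenize0 mul0r.
have szaj : (0 < size (a j))%N by rewrite size_poly_gt0.
have := aP j; have -> : (d - dd j = \sum_(j' | j' != j) dd j')%N.
  by rewrite [d](bigD1 j) //= addKn.
set D := (\sum_(j' | _) dd j')%N => szm.
pose s := [seq j' <- index_enum 'I_r | j' != j].
have DE : D = (\sum_(j' <- s) dd j')%N by rewrite big_filter.
have mE : m = (D + (m - D))%N by move: szm; move: (size _) szaj => z z0; lia.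
have -> : ucofactor dd j = \prod_(j' <- s) (ulin j' : {poly K}) ^+ dd j'.
  by rewrite [RHS]big_filter.
have -> : cofactor special i j = \prod_(j' <- s) special i j'.
  by rewrite [RHS]big_filter.
rewrite {1}mE [a j * _]mulrC {1}DE homogenize_prod; first by rewrite mulrC.
by move: szm; move: (size _) szaj => z z0; lia.
Qed.

(** In degrees below [d] the cofactors satisfy no relation and all their
    multiples count. In degree [d] the [r] multiples equal to the product of
    all forms coincide, and the sum [d + r] overcounts by [r - 1]. *)
Definition lead_count m := if m == d then d.+1 else (\sum_j (m.+1 - (d - dd j)))%N.

Hypothesis d_gt0 : (0 < d)%N.

(** There may be more than [lead_count m] leading degrees. Choosing exactly
    that many turns the numbers of monomials computed later into identities,
    while they still bound dimensions from below. *)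
Lemma exists_lead_pred : exists S : nat -> nat -> bool, forall m, (m <= d)%N ->
  #|[pred k : 'I_m.+1 | S m k]| = lead_count m /\
  forall k, (k <= m)%N -> S m k -> exists2 p : {poly K}, upart dd m p & size p = k.+1.
Proof.
have ex m : exists S : nat -> bool, (m <= d)%N ->
    #|[pred k : 'I_m.+1 | S k]| = lead_count m /\
    forall k, (k <= m)%N -> S k -> exists2 p : {poly K}, upart dd m p & size p = k.+1.
  have [md|] := leqP m d; last by exists (fun=> false).
  have le_card : (lead_count m <= #|lead_degrees (K := K) dd m|)%N.
    rewrite /lead_count; case: eqP => [mE|/eqP md'].
      have full := lead_degrees_top charK d_gt0 (or_intror mE).
      have -> : #|lead_degrees (K := K) dd m| = #|'I_m.+1|.
        by apply: eq_card => k; rewrite full.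
      by rewrite card_ord mE.
    by apply: card_lead_degrees => //; rewrite ltn_neqAle md'.
  pose s := take (lead_count m) (enum (lead_degrees (K := K) dd m)).
  exists (fun k => k \in map val s) => _; split.
    rewrite -[RHS](_ : size s = _); last by rewrite size_take -cardE; case: ltngtP le_card.
    rewrite -(card_uniqP _); last by rewrite take_uniq ?enum_uniq.
    by apply: eq_card => k; rewrite inE mem_map //; apply: val_inj.
  move=> k km /mapP[k' /mem_take]; rewrite mem_enum inE => /asboolP.
  by move=> [p pU szp] ->; exists p.
by have [S SP] := choice ex; exists S.
Qed.

(** A monomial in [T] is a family of [l] binary monomials [x_i^a y_i^b], the
    pair [(a, b)] being marked by [eps] if it is a chosen leading monomial of
    the binary ideal. A marked pair is the leading monomial of a form in the
    ideal [J_i], an unmarked one represents itself, and the product of these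
    forms lies in the sum of the ideals if one pair is marked, and in a
    product of two of them if two are. *)
Lemma exists_special_counts : exists eps : pred ('I_d.+1 * 'I_d.+1),
  [/\ forall m, (m <= d)%N ->
        #|[pred x : 'I_d.+1 * 'I_d.+1 | (x.1 + x.2 == m)%N && eps x]| = lead_count m,
      forall e, (e <= d)%N ->
        (#|[pred f : {ffun 'I_l -> 'I_d.+1 * 'I_d.+1} |
            (\sum_i ((f i).1 + (f i).2) == e)%N && [exists i, eps (f i)]]|
         <= \dim (ideal_part e (sum_gens special l)))%N &
      forall k : 'I_l,
        (#|[pred f : {ffun 'I_l -> 'I_d.+1 * 'I_d.+1} |
            (\sum_i ((f i).1 + (f i).2) == d)%N &&
            (eps (f k) && [exists i : 'I_l, (i < k)%N && eps (f i)])]|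
         <= \dim (ideal_part d (prod_gens special k)))%N].
Proof.
have [S SP] := exists_lead_pred.
pose eps (x : 'I_d.+1 * 'I_d.+1) := (x.1 + x.2 <= d)%N && S (x.1 + x.2)%N x.1.
exists eps.
pose mon i (x : 'I_d.+1 * 'I_d.+1) : 'X_{1..n.+2} := (U_(xvar i) *+ x.1 + U_(yvar i) *+ x.2)%MM.
have exq (ix : 'I_l * ('I_d.+1 * 'I_d.+1)) : exists q : {mpoly K[n.+2]},
    [/\ q != 0, mlead q = mon ix.1 ix.2, q \is (ix.2.1 + ix.2.2)%N.-homog &
        eps ix.2 -> in_cofactors ix.1 q].
  case: ix => i [a b] /=; have [/andP[abd Sab]|neps] := boolP (eps (a, b)).
    have [_ /(_ a (leq_addr _ _) Sab)[p pU szp]] := SP _ abd.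
    have [] := @mlead_homogenize K _ (xvar i) (yvar i) (ltnSn _) _ _ _ szp (leq_addr b a).
    rewrite addKn => h0 hl; exists (homogenize (xvar i) (yvar i) (a + b) p).
    split=> //; first exact: homogenize_homog.
    by move=> _; apply: homogenize_upart.
  exists 'X_[mon i (a, b)]; split.
  - by rewrite -msize_poly_eq0 msizeX.
  - by rewrite mleadXm.
  - by rewrite dhomogX; apply/eqP; rewrite /= mdegD !mdegMn !mdeg1 !mul1n.
  - by [].
have [q qP] := choice exq.
pose w (f : {ffun 'I_l -> 'I_d.+1 * 'I_d.+1}) := \prod_i q (i, f i).
pose mu (f : {ffun 'I_l -> 'I_d.+1 * 'I_d.+1}) := (\sum_i mon i (f i))%MM.
have mux (f : {ffun 'I_l -> 'I_d.+1 * 'I_d.+1}) i : mu f (xvar i) = (f i).1 /\ mu f (yvar i) = (f i).2.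
  have nxy j1 j2 : (xvar j1 == yvar j2) = false by apply/eqP => /(congr1 val) /=; lia.
  have xvar_inj j : (xvar j == xvar i) = (j == i).
    by apply/eqP/eqP => [/(congr1 val) /= E|->] //; apply: val_inj => /=; lia.
  have yvar_inj j : (yvar j == yvar i) = (j == i).
    by apply/eqP/eqP => [/(congr1 val) /= E|->] //; apply: val_inj => /=; lia.
  rewrite /mu !mnm_sumE; split; rewrite (bigD1 i) //= [X in (_ + X)%N]big1 => [|j /negPf ji].
  - by rewrite mnmDE !mulmnE !mnm1E xvar_inj eqxx eq_sym nxy mul1n mul0n !addn0.
  - by rewrite mnmDE !mulmnE !mnm1E xvar_inj ji eq_sym nxy.
  - by rewrite mnmDE !mulmnE !mnm1E yvar_inj eqxx nxy mul1n mul0n addn0.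
  - by rewrite mnmDE !mulmnE !mnm1E yvar_inj ji nxy.
have mu_inj : injective mu.
  move=> f g fg; apply/ffunP => i; have [f1 f2] := mux f i; have [g1 g2] := mux g i.
  rewrite [LHS]surjective_pairing [RHS]surjective_pairing.
  by congr (_, _); apply: val_inj; rewrite /= -?f1 -?f2 -?g1 -?g2 fg.
have w0 f : w f != 0.
  by apply/prodf_neq0 => i _; have [] := qP (i, f i).
have wlead f : mlead (w f) = mu f.
  rewrite mlead_prod => [|i _]; last by have [] := qP (i, f i).
  by apply: eq_bigr => i _; have [] := qP (i, f i).
have whom f : w f \is (\sum_i ((f i).1 + (f i).2))%N.-homog.
  by apply: dhomog_prodr => i _; have [] := qP (i, f i).
split.
- move=> m md; have [<- _] := SP m md.
  pose h (k : 'I_m.+1) : 'I_d.+1 * 'I_d.+1 := (inord k, inord (m - k)).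
  have hE (k : 'I_m.+1) : ((h k).1 = k :> nat) /\ ((h k).2 = (m - k)%N :> nat).
    have km : (k <= m)%N by rewrite -ltnS.
    by rewrite !inordK // ltnS ?(leq_trans (leq_subr _ _)) ?(leq_trans km).
  have h_inj : injective h.
    move=> k1 k2 E; apply: val_inj => /=.
    by have [<- _] := hE k1; have [<- _] := hE k2; rewrite E.
  rewrite -(card_image h_inj); apply: eq_card => x; rewrite [LHS]inE.
  apply/idP/fintype.imageP => [/andP[/eqP xm /andP[_ Sx]]|[k]]; last first.
    have [h1 h2] := hE k; have km : (k <= m)%N by rewrite -ltnS.
    by rewrite inE => Sk ->; rewrite /eps h1 h2 subnKC // md eqxx.
  have x1m : (x.1 < m.+1)%N by rewrite ltnS -xm leq_addr.
  exists (Ordinal x1m); first by rewrite inE /= -{1}xm.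
  have [h1 h2] := hE (Ordinal x1m).
  rewrite [LHS]surjective_pairing [RHS]surjective_pairing; congr (_, _); apply: val_inj.
    by rewrite [RHS]h1.
  by rewrite [RHS]h2 /= -{1}xm addKn.
- move=> e ed; apply: (dim_geq_leads mu_inj (w := w)) => f.
  rewrite inE => /andP[/eqP fe /existsP[i fi]]; split=> //; first by rewrite -fe.
  have [_ _ _ /(_ fi)[H qE]] := qP (i, f i).
  rewrite /w (bigD1 i) //= qE mulr_suml linear_sum; apply: memv_suml => j _ /=.
  rewrite -mulrA mulrCA.
  have := mem_ideal_part e (sum_gens special l) (i, j).
  by rewrite /sum_gens /= ltn_ord.
- move=> k; apply: (dim_geq_leads mu_inj (w := w)) => f.
  rewrite inE => /andP[/eqP fe /andP[fk /existsP[i /andP[ik fi]]]].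
  split=> //; first by rewrite -fe.
  have [_ _ _ /(_ fi)[H qE]] := qP (i, f i).
  have [_ _ _ /(_ fk)[H' qE']] := qP (k, f k).
  have nki : k != i by rewrite eq_sym -val_eqE ltn_eqF.
  rewrite /w (bigD1 i) //= (bigD1 k) //= qE qE' mulr_suml linear_sum.
  apply: memv_suml => j _ /=; rewrite mulr_suml mulr_sumr linear_sum.
  apply: memv_suml => j' _ /=.
  set R := \prod_(_ < _ | _) _.
  have -> : H j * cofactor special i j * (H' j' * cofactor special k j' * R) =
      prod_gens special k (i, j, j') * (H j * H' j' * R).
    by rewrite /prod_gens /sum_gens /= ik; ring.
  exact: mem_ideal_part.
Qed.

End SpecialTuple.

(** * Truncated generating functions *)

Lemma Posz_sum (I : Type) (r : seq I) (P : pred I) (F : I -> nat) :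
  (\sum_(i <- r | P i) F i)%N%:Z = \sum_(i <- r | P i) (F i)%:Z.
Proof. exact: (big_morph Posz PoszD). Qed.

Section Truncated.
Context (D : nat).
Implicit Types p q : {poly int}.

(** Power series up to order [D], as polynomials modulo [X^D]. *)
Definition congX p q := exists s, p = q + s * 'X^D.

Lemma congX_refl p : congX p p.
Proof. by exists 0; rewrite mul0r addr0. Qed.

Lemma congX_sym p q : congX p q -> congX q p.
Proof. by case=> s ->; exists (- s); ring. Qed.

Lemma congX_trans q p p' : congX p q -> congX q p' -> congX p p'.
Proof. by case=> s -> [s' ->]; exists (s + s'); ring. Qed.

Lemma congXD p q p' q' : congX p q -> congX p' q' -> congX (p + p') (q + q').
Proof. by case=> s -> [s' ->]; exists (s + s'); ring. Qed.

Lemma congXN p q : congX p q -> congX (- p) (- q).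
Proof. by case=> s ->; exists (- s); ring. Qed.

Lemma congXM p q p' q' : congX p q -> congX p' q' -> congX (p * p') (q * q').
Proof. by case=> s -> [s' ->]; exists (q * s' + s * q' + s * s' * 'X^D); ring. Qed.

Lemma congXX k p q : congX p q -> congX (p ^+ k) (q ^+ k).
Proof.
move=> pq; elim: k => [|k IHk]; first exact: congX_refl.
by rewrite !exprS; apply: congXM.
Qed.

Lemma congX_Xn k : (D <= k)%N -> congX 'X^k 0.
Proof. by move=> Dk; exists 'X^(k - D); rewrite add0r -exprD subnK. Qed.

Lemma congX_coef p q m : congX p q -> (m < D)%N -> p`_m = q`_m.
Proof. by case=> s -> mD; rewrite coefD coefMXn mD addr0. Qed.

Lemma coef_congX p q : (forall m, (m < D)%N -> p`_m = q`_m) -> congX p q.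
Proof.
move=> pq; exists (drop_poly D (p - q)).
rewrite -[LHS](subrK q) addrC; congr (_ + _).
rewrite -{1}(poly_take_drop D (p - q)).
have -> : take_poly D (p - q) = 0; last by rewrite add0r.
apply/polyP => m; rewrite coef_take_poly coef0 coefB.
by case: ltnP => // /pq ->; rewrite subrr.
Qed.

(** The series [1 / (1 - X)] up to order [D]. *)
Definition geom : {poly int} := \sum_(i < D) 'X^i.

Lemma geomE : (1 - 'X) * geom = 1 - 'X^D.
Proof. by rewrite -opprB mulNr -subrX1 opprB. Qed.

Lemma congX_geom : congX ((1 - 'X) * geom) 1.
Proof. by exists (-1); rewrite geomE; ring. Qed.

Lemma coef_geom m : (m < D)%N -> geom`_m = 1.
Proof.
move=> mD; rewrite coef_sum (bigD1 (Ordinal mD)) //= coefXn eqxx big1 ?addr0 //.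
by move=> i; rewrite coefXn -val_eqE /= eq_sym => /negPf ->.
Qed.

Lemma coef_geomX v m : (m < D)%N -> (geom ^+ v.+1)`_m = ('C(m + v, v))%:Z.
Proof.
elim: v m => [|v IHv] m mD; first by rewrite expr1 bin0 coef_geom.
rewrite exprS coefMr (eq_bigr (fun j : 'I_m.+1 => ('C(j + v, v))%:Z)); last first.
  move=> j _; have jm : (j <= m)%N by rewrite -ltnS.
  by rewrite IHv ?coef_geom ?mul1r // ?(leq_ltn_trans _ mD) // leq_subr.
elim: m {mD} => [|m IHm]; first by rewrite big_ord_recl big_ord0 addr0 !add0n !binn.
rewrite big_ord_recr /= IHm -PoszD; congr Posz.
by rewrite [in RHS]addSn binS addnS addSn.
Qed.

(** Expanding the product chooses the members of the family independently. *)
Lemma coef_count l (X : finType) (wt : X -> nat) (Q : 'I_l -> pred X) m :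
  (#|[pred f : {ffun 'I_l -> X} | (\sum_i wt (f i) == m)%N && [forall i, Q i (f i)]]|)%:Z =
  (\prod_i \sum_(x | Q i x) 'X^(wt x) : {poly int})`_m.
Proof.
rewrite bigA_distr_big_dep coef_sum.
rewrite (eq_bigr (fun f : {ffun 'I_l -> X} => ((\sum_i wt (f i))%N == m)%:R : int)).
  rewrite -sum1_card Posz_sum big_mkcond [RHS]big_mkcond /=.
  apply: eq_bigr => f _; rewrite inE.
  have -> : (f \in family (fun i : 'I_l => Q i)) = [forall i, Q i (f i)].
    by apply/familyP/forallP => fQ i; exact: fQ.
  by case: eqP; case: [forall i, _].
move=> f _; have -> : \prod_i 'X^(wt (f i)) = 'X^(\sum_i wt (f i)) :> {poly int}.
  elim/big_rec2: _ => [|i k p _ ->]; first by rewrite expr0.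
  by rewrite exprD.
by rewrite coefXn eq_sym.
Qed.

End Truncated.

(** * Counting *)

Section Counting.
Context {l r : nat} (dd : 'I_r -> nat).
Local Notation d := (\sum_j dd j)%N.
Hypothesis r_gt0 : (0 < r)%N.
Context (eps : pred ('I_d.+1 * 'I_d.+1)).
Hypothesis epsP : forall m, (m <= d)%N ->
  #|[pred x : 'I_d.+1 * 'I_d.+1 | (x.1 + x.2 == m)%N && eps x]| = lead_count dd m.

Local Notation ffT := {ffun 'I_l -> 'I_d.+1 * 'I_d.+1}.
Local Notation wt f := (\sum_i ((f i).1 + (f i).2))%N.
Local Notation g := (geom d.+1).

Definition eps_poly : {poly int} := \sum_(x | eps x) 'X^(x.1 + x.2).

(** In two variables the Hilbert series of the ideal of the cofactors is this
    polynomial over [(1 - X)^2], as it has [r] generators of degrees [d - dd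
    j] and [r - 1] relations in degree [d]. *)
Definition cofactor_numerator : {poly int} := \sum_j 'X^(d - dd j) - (r%:R - 1) * 'X^d.

(** Hilbert series of the polynomial ring in two variables. *)
Lemma sum_pairs : \sum_(x : 'I_d.+1 * 'I_d.+1) 'X^(x.1 + x.2) = g ^+ 2 :> {poly int}.
Proof.
rewrite expr2 /geom mulr_suml.
transitivity (\sum_(a < d.+1) \sum_(b < d.+1) 'X^(a + b) : {poly int}).
  by rewrite pair_bigA.
by apply: eq_bigr => a _; rewrite mulr_sumr; apply: eq_bigr => b _; rewrite exprD.
Qed.

Lemma congX_mulXd p : congX d.+1 (p * 'X^d) (p`_0 *: 'X^d).
Proof.
apply: coef_congX => m; rewrite ltnS => md; rewrite coefMXn coefZ coefXn.
case: ltngtP md => // [_ _|-> _]; first by rewrite mulr0.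
by rewrite subnn mulr1.
Qed.

(** In degree [d] the subtraction of [r - 1] accounts for the difference
    between [d + r] and [lead_count dd d = d.+1]. *)
Lemma eps_poly_cong : congX d.+1 eps_poly (cofactor_numerator * g ^+ 2).
Proof.
(* Only the constant term of [g ^+ 2] matters next to ['X^d]. *)
have geom0 : (g ^+ 2)`_0 = 1 by rewrite coef_geomX // bin1.
apply: congX_trans (_ : congX _ (\sum_j 'X^(d - dd j) * g ^+ 2 - (r%:R - 1) * 'X^d) _).
  apply: coef_congX => m; rewrite ltnS => md.
  have -> : eps_poly`_m = (lead_count dd m)%:Z.
    rewrite -(epsP md) -sum1_card Posz_sum coef_sum [LHS]big_mkcond [RHS]big_mkcond.
    apply: eq_bigr => x _; rewrite coefXn inE eq_sym andbC.
    by case: (eps x) => //; case: eqP.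
  rewrite coefB coef_sum (eq_bigr (fun j => (m.+1 - (d - dd j))%N%:Z)); last first.
    move=> j _; rewrite coefXnM; case: ltnP => [mj|jm].
      by have /eqP -> : (m.+1 - (d - dd j) == 0)%N by rewrite subn_eq0.
    rewrite coef_geomX ?bin1 ?addn1 ?subSn //.
    by rewrite ltnS (leq_trans (leq_subr _ _)).
  have -> : ((r%:R - 1) * 'X^d : {poly int})`_m = (r%:R - 1) * (m == d)%:R.
    by rewrite -[1](rmorph1 polyC) -(rmorph_nat polyC) -rmorphB /= coefCM coefXn.
  rewrite -Posz_sum /lead_count; case: eqP => [->|_].
    rewrite mulr1 (eq_bigr (fun j => dd j + 1)%N) => [|j _].
      by rewrite big_split /= sum1_card card_ord; lia.
    by have := leq_dd dd j; move: (dd j) d => x y; lia.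
  by rewrite mulr0 subr0.
have -> : cofactor_numerator * g ^+ 2 = \sum_j 'X^(d - dd j) * g ^+ 2 - (r%:R - 1) * ('X^d * g ^+ 2).
  by rewrite /cofactor_numerator mulrBl mulr_suml -!mulrA.
apply: congXD; first exact: congX_refl.
apply: congXN; apply: congXM; first exact: congX_refl.
apply: congX_sym; rewrite mulrC; apply: congX_trans (congX_mulXd _) _.
by rewrite geom0 scale1r; apply: congX_refl.
Qed.

Definition count_all m := #|[pred f : ffT | wt f == m]|.
Definition count_some m := #|[pred f : ffT | (wt f == m) && [exists i, eps (f i)]]|.
Definition count_none m := #|[pred f : ffT | (wt f == m) && [forall i, ~~ eps (f i)]]|.
Definition count_at k := #|[pred f : ffT | (wt f == d) && eps (f k)]|.
(** Leading monomials in the product of [J_k] with the sum of the earlier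
    ideals: an earlier pair is marked besides the [k]-th. *)
Definition count_first k := #|[pred f : ffT | (wt f == d) &&
  (eps (f k) && [exists i : 'I_l, (i < k)%N && eps (f i)])]|.

Lemma count_some_none m : (count_some m + count_none m = count_all m)%N.
Proof.
rewrite /count_all -(cardID (fun f : ffT => [exists i, eps (f i)])).
by congr addn; apply: eq_card => f; rewrite !inE andbC // negb_exists.
Qed.

(** The sum on the left misses exactly the first index satisfying [P]. *)
Lemma sum_first (P : pred 'I_l) :
  (\sum_k (P k && [exists i : 'I_l, (i < k)%N && P i]) + [exists i, P i] = \sum_k P k)%N.
Proof.
have [[i0 Pi0]|] := altP existsP; last first.
  by move/existsPn => nP; rewrite !big1 // => k _; rewrite (negPf (nP k)).
case: (arg_minnP (fun i : 'I_l => i : nat) Pi0) => k Pk kmin.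
rewrite (bigD1 k) //= [RHS](bigD1 k) //= Pk.
have -> : [exists i : 'I_l, (i < k)%N && P i] = false.
  by apply/existsP => -[i /andP[ik /kmin]]; rewrite leqNgt ik.
rewrite add0n addnC; congr (_ + _)%N; apply: eq_bigr => i ik.
case Pi : (P i) => //=; suff -> : [exists i' : 'I_l, (i' < i)%N && P i'] by [].
apply/existsP; exists k.
by rewrite Pk andbT ltn_neqAle kmin // andbT eq_sym val_eqE ik.
Qed.

Lemma sum_count_first : (\sum_k count_first k + count_some d = \sum_k count_at k)%N.
Proof.
have cardE (P Q : pred ffT) : #|[pred f | P f && Q f]| = (\sum_(f | P f) Q f)%N.
  by rewrite -sum1_card big_mkcondr; apply: eq_bigr => f _; case: (Q f).
rewrite /count_some cardE (eq_bigr _ (fun k _ => cardE _ _)) exchange_big -big_split /=.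
rewrite [RHS](eq_bigr _ (fun k _ => cardE _ _)) [RHS]exchange_big.
by apply: eq_bigr => f _; apply: sum_first.
Qed.

Context {n : nat} (n_eq : n.+2 = (2 * l)%N).

Lemma count_allE m : (m <= d)%N -> count_all m = 'C(m + n.+1, n.+1).
Proof.
move=> md; have := coef_count (fun x : 'I_d.+1 * 'I_d.+1 => x.1 + x.2)%N (fun (_ : 'I_l) _ => true) m.
rewrite (eq_bigr (fun=> g ^+ 2)) => [|i _]; last exact: sum_pairs.
rewrite prodr_const card_ord -exprM -n_eq coef_geomX ?ltnS // => -[<-].
by apply: eq_card => f; rewrite !inE; case: forallP => [|[]] //; rewrite andbT.
Qed.

(** Equality in [dim_cofactors]: the marked pair at [k] contributes the
    numerator over [(1 - X)^2] and the other [l - 1] pairs contribute [1 / (1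
    - X)^2] each. *)
Lemma count_atE k : (count_at k + r.-1 = \sum_j 'C(dd j + n.+1, n.+1))%N.
Proof.
have geom0 v : (g ^+ v.+1)`_0 = 1 by rewrite coef_geomX // add0n binn.
have := coef_count (fun x : 'I_d.+1 * 'I_d.+1 => x.1 + x.2)%N
  (fun i x => (i == k) ==> eps x) d.
rewrite (bigD1 k) //= [\prod_(i | i != k) _](eq_bigr (fun=> g ^+ 2)) => [|i /negPf ik]; last first.
  by rewrite -sum_pairs; apply: eq_bigl => x; rewrite ik.
rewrite prodr_const cardC1 card_ord -exprM.
rewrite (eq_bigl eps) => [|x]; last by rewrite eqxx.
rewrite -/eps_poly (congX_coef (congXM eps_poly_cong (congX_refl _ _)) (ltnSn _)).
rewrite -mulrA -exprD.
have -> : (2 + 2 * l.-1 = n.+2)%N by rewrite n_eq; case: (l) k => [[]//|l' _]; rewrite /= mulnS.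
have -> : cofactor_numerator * g ^+ n.+2 = \sum_j 'X^(d - dd j) * g ^+ n.+2 - (r%:R - 1)%:P * (g ^+ n.+2 * 'X^d).
  by rewrite /cofactor_numerator mulrBl mulr_suml rmorphB rmorph1 rmorph_nat; ring.
rewrite coefB coefCM coefMXn ltnn subnn geom0 mulr1 coef_sum.
rewrite (eq_bigr (fun j => ('C(dd j + n.+1, n.+1))%:Z)) => [|j _]; last first.
  by rewrite coefXnM ltnNge leq_subr /= subKn ?leq_dd // coef_geomX // ltnS leq_dd.
rewrite -Posz_sum.
have -> : #|[pred f : ffT | (wt f == d) && [forall i, (i == k) ==> eps (f i)]]| = count_at k.
  apply: eq_card => f; rewrite !inE; congr (_ && _); apply/forallP/idP => [/(_ k)|fk i].
    by rewrite eqxx.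
  by apply/implyP => /eqP ->.
by move: (count_at k) (\sum_j 'C(_, _))%N => x y; lia.
Qed.

(** The unmarked pairs have generating function [1 / (1 - X)^2 - eps_poly]. *)
Lemma count_noneE m : (count_none m)%:Z = ((g ^+ 2 - eps_poly) ^+ l : {poly int})`_m.
Proof.
rewrite [LHS](coef_count (fun x : 'I_d.+1 * 'I_d.+1 => x.1 + x.2)%N
  (fun (_ : 'I_l) x => ~~ eps x) m).
rewrite prodr_const card_ord.
suff -> : \sum_(x | ~~ eps x) 'X^(x.1 + x.2) = g ^+ 2 - eps_poly by [].
by rewrite -sum_pairs [X in _ = X - _](bigID eps) /= /eps_poly addrAC subrr add0r.
Qed.

(** Taking differences of consecutive coefficients is multiplication by [1 -
    X], which lowers the exponent of the denominator from [2l] to [2l - 1],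
    the number of variables of [S]. *)
Lemma count_none_diff e : d = e.+1 ->
  (count_none d)%:Z - (count_none e)%:Z =
  (g ^+ n.+1 * (1 - cofactor_numerator) ^+ l : {poly int})`_d.
Proof.
move=> de; rewrite !count_noneE; set c := (g ^+ 2 - eps_poly).
have -> : (c ^+ l)`_d - (c ^+ l)`_e = ((1 - 'X) * c ^+ l)`_d.
  by rewrite mulrBl mul1r coefB coefXM de.
apply: (@congX_coef d.+1); last exact: ltnSn.
have cE : congX d.+1 c (g ^+ 2 * (1 - cofactor_numerator)).
  rewrite mulrBr mulr1 [g ^+ 2 * cofactor_numerator]mulrC.
  by apply: congXD; [apply: congX_refl|apply/congXN/eps_poly_cong].
apply: congX_trans (congXM (congX_refl _ _) (congXX l cE)) _.
rewrite exprMn -exprM -n_eq exprS.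
have -> : (1 - 'X) * (g * g ^+ n.+1 * (1 - cofactor_numerator) ^+ l) =
  ((1 - 'X) * g) * (g ^+ n.+1 * (1 - cofactor_numerator) ^+ l) by ring.
rewrite -[X in congX _ _ X]mul1r.
by apply: congXM (congX_geom _) (congX_refl _ _).
Qed.

End Counting.

(** * The predicted coefficient *)

Section Prediction.
Context (d1 d2 : nat) (t : seq nat) (n l : nat).
Local Notation la := [:: d1, d2 & t].
Hypothesis la_partition : is_partition_of (sumn la) la.
Hypothesis l_ge2 : (2 <= l)%N.
Local Notation d := (sumn la).
Local Notation u := (d - d1)%N.
Local Notation cong := (congX d.+1).
Local Notation g := (geom d.+1).

Definition partition_poly : {poly int} :=
  \sum_(x <- la) 'X^(d - x) - ((size la)%:R - 1) * 'X^d.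

Lemma partition_bounds : [/\ (1 <= d2)%N, (d2 <= d1)%N & forall x, x \in t -> (1 <= x <= d2)%N].
Proof.
have /and3P[/= /andP[d21 pt] la0 _] := la_partition.
have [d10 [d20 t0]] : 0%N != d1 /\ 0%N != d2 /\ 0%N \notin t.
  by move: la0; rewrite !inE !negb_or => /and3P[].
split=> // [|x xt]; first by rewrite lt0n eq_sym.
rewrite lt0n (contraNneq _ t0) => [/=|<-//].
have tr : transitive geq by move=> y x' z xy yz; apply: leq_trans yz xy.
by have /allP/(_ x xt) := order_path_min tr pt.
Qed.

Lemma leq_mem_sumn x (s : seq nat) : x \in s -> (x <= sumn s)%N.
Proof.
elim: s => // y s IHs; rewrite inE => /orP[/eqP ->|/IHs] /=; first exact: leq_addr.
by move=> xs; apply: leq_trans xs (leq_addl _ _).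
Qed.

Definition tail_poly : {poly int} := \sum_(x <- t) 'X^(d - x).

Lemma partition_polyE : partition_poly = 'X^u + 'X^(d - d2) + tail_poly - ((size la)%:R - 1) * 'X^d.
Proof. by rewrite /partition_poly !big_cons addrA. Qed.

Lemma cong_Xd k : (0 < k)%N -> cong ('X^k * 'X^d) 0.
Proof. by move=> k0; rewrite -exprD; apply: congX_Xn; rewrite -add1n leq_add2r. Qed.

(** For [x] in [t] one has [x + y <= sumn t + d1 < d], as [d2] is positive;
    hence [d - x + k >= d - x + (d - y) > d]. *)
Lemma cong_tail k y : (y <= d1)%N -> (d - y <= k)%N -> cong (tail_poly * 'X^k) 0.
Proof.
move=> yd1 dk; rewrite /tail_poly mulr_suml big_seq.
apply: (big_ind (fun p => cong p 0)) => [|p q p0 q0|x xt]; first exact: congX_refl.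
  by rewrite -[0]addr0; apply: congXD.
rewrite -exprD; apply: congX_Xn.
have [d20 _ _] := partition_bounds; have := leq_mem_sumn xt.
by move: dk => /=; move: (sumn t) => z; lia.
Qed.

Lemma u_gt0 : (0 < u)%N.
Proof. by have [d20 _ _] := partition_bounds; rewrite /=; lia. Qed.

Lemma partition_poly_mulXd : cong (partition_poly * 'X^d) 0.
Proof.
have [d20 d21 _] := partition_bounds.
have -> : partition_poly * 'X^d = 'X^u * 'X^d + 'X^(d - d2) * 'X^d + tail_poly * 'X^d
    - ((size la)%:R - 1) * ('X^d * 'X^d) by rewrite partition_polyE; ring.
rewrite -[0]subr0 -[X in congX _ _ (X - _)]addr0 -[X in congX _ _ (X + _ - _)]addr0.
apply: congXD; first apply: congXD; first apply: congXD.
- exact/cong_Xd/u_gt0.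
- by apply: cong_Xd; rewrite /=; lia.
- by apply: (@cong_tail d 0) => //; rewrite subn0.
apply: congXN; rewrite -[X in congX _ _ X](mulr0 ((size la)%:R - 1)).
by apply: congXM; [apply: congX_refl|apply: cong_Xd; rewrite /=; lia].
Qed.

(** The terms other than that of [d1] have degree at least [d - d2], and [u >=
    d2 > 0], so that multiplication by [X^(2 * u)] raises their degrees above
    [d]. *)
Lemma partition_poly_mulX k : (2 <= k)%N -> cong (partition_poly * 'X^(k * u)) 'X^(k.+1 * u).
Proof.
move=> k2; have [d20 d21 _] := partition_bounds; have u0 := u_gt0.
have -> : partition_poly * 'X^(k * u) = 'X^(k.+1 * u) + 'X^(d - d2) * 'X^(k * u)
    + tail_poly * 'X^(k * u) - ((size la)%:R - 1) * ('X^(k * u) * 'X^d).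
  by rewrite partition_polyE mulSn exprD; ring.
have le2 : (2 * u <= k * u)%N by rewrite leq_mul2r k2 orbT.
rewrite -[X in congX _ _ X]subr0 -[X in congX _ _ (X - _)]addr0.
rewrite -[X in congX _ _ (X + _ - _)]addr0.
apply: congXD; first apply: congXD; first apply: congXD.
- exact: congX_refl.
- rewrite -exprD; apply: congX_Xn; move: le2 u0; move: (k * u)%N => z /=; lia.
- by apply: (@cong_tail _ d1) => //; move: le2; move: (k * u)%N u => z z'; lia.
apply: congXN; rewrite -[X in congX _ _ X](mulr0 ((size la)%:R - 1)).
apply: congXM; first exact: congX_refl.
by apply: cong_Xd; move: le2 u0; move: (k * u)%N u => z z'; lia.
Qed.

(** Coefficient of [X^d] in the square of the partition polynomial, besides
    [X^(2 * u)]: the products of the terms of [d1] and [d2], or of [d2] with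
    itself, have degree [d] exactly when [d1 + d2 = d] or [2 * d2 = d]. *)
Definition square_correction : nat := 2 * (d1 + d2 == d) + (2 * d2 == d).

Lemma cong_Xdz z : cong 'X^(d + z) ((z == 0)%N%:R * 'X^d).
Proof.
case: z => [|z]; first by rewrite addn0 mul1r; apply: congX_refl.
by rewrite mul0r; apply: congX_Xn; rewrite addnS ltnS leq_addr.
Qed.

Lemma partition_poly_sqr : cong (partition_poly ^+ 2) ('X^(2 * u) + square_correction%:R * 'X^d).
Proof.
have [d20 d21 tP] := partition_bounds; have u0 := u_gt0.
have AB : cong ('X^u * 'X^(d - d2)) ((d1 + d2 == d)%N%:R * 'X^d).
  have -> : (d1 + d2 == d)%N = (d - (d1 + d2) == 0)%N by rewrite /=; lia.
  rewrite -exprD (_ : u + (d - d2) = d + (d - (d1 + d2)))%N; first exact: cong_Xdz.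
  by rewrite /=; lia.
have BB : cong ('X^(d - d2) * 'X^(d - d2)) ((2 * d2 == d)%N%:R * 'X^d).
  have -> : (2 * d2 == d)%N = (d - 2 * d2 == 0)%N by rewrite /=; lia.
  rewrite -exprD (_ : d - d2 + (d - d2) = d + (d - 2 * d2))%N; first exact: cong_Xdz.
  by rewrite /=; lia.
have AT : cong (tail_poly * 'X^u) 0 by apply: (@cong_tail _ d1).
have BT : cong (tail_poly * 'X^(d - d2)) 0 by apply: (@cong_tail _ d2).
have TT : cong (tail_poly * tail_poly) 0.
  rewrite {2}/tail_poly mulr_sumr big_seq.
  apply: (big_ind (fun p => cong p 0)) => [|p q p0 q0|x xt]; first exact: congX_refl.
    by rewrite -[0]addr0; apply: congXD.
  by apply: (@cong_tail _ x) => //; have := tP x xt; lia.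
have -> : partition_poly ^+ 2 = 'X^(2 * u) + ('X^u * 'X^(d - d2) + 'X^u * 'X^(d - d2)
      + 'X^(d - d2) * 'X^(d - d2))
    + (tail_poly * 'X^u + tail_poly * 'X^u) + (tail_poly * 'X^(d - d2) + tail_poly * 'X^(d - d2))
    + tail_poly * tail_poly - ((size la)%:R - 1) * (partition_poly * 'X^d)
    - ((size la)%:R - 1) * (partition_poly * 'X^d) - ((size la)%:R - 1) ^+ 2 * ('X^d * 'X^d).
  by rewrite partition_polyE mul2n -addnn exprD; ring.
have -> : 'X^(2 * u) + square_correction%:R * 'X^d = 'X^(2 * u) + ((d1 + d2 == d)%N%:R * 'X^d
     + (d1 + d2 == d)%N%:R * 'X^d + (2 * d2 == d)%N%:R * 'X^d) + (0 + 0) + (0 + 0) + 0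
     - ((size la)%:R - 1) * 0 - ((size la)%:R - 1) * 0 - ((size la)%:R - 1) ^+ 2 * 0 :> {poly int}.
  by rewrite /square_correction natrD natrM; ring.
have W0 := partition_poly_mulXd.
have DD : cong ('X^d * 'X^d) 0 by apply: cong_Xd; rewrite /=; lia.
by do ![exact: congX_refl | assumption | apply: congXD | apply: congXN | apply: congXM].
Qed.

Lemma partition_poly_pow k : (2 <= k)%N ->
  cong (partition_poly ^+ k) ('X^(k * u) + ((k == 2)%N * square_correction)%:R * 'X^d).
Proof.
elim: k => // k IHk; rewrite leq_eqVlt => /orP[/eqP <-|].
  by rewrite eqxx mul1n; apply: partition_poly_sqr.
rewrite ltnS => k2; have -> : (k.+1 == 2)%N = false by lia.
rewrite mul0n mul0r addr0 exprS.
apply: congX_trans (congXM (congX_refl _ _) (IHk k2)) _.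
rewrite mulrDr mulrCA -[X in congX _ _ X]addr0; apply: congXD; first exact: partition_poly_mulX.
rewrite -[X in congX _ _ X](mulr0 (((k == 2)%N * square_correction)%:R)).
exact: congXM (congX_refl _ _) partition_poly_mulXd.
Qed.

(** The Hilbert function of a polynomial ring in [n + 1] variables. *)
Definition hz (z : int) : int := binz (z + n.+1%:Z - 1) n.

Lemma coef_geom_Xn m : (g ^+ n.+1 * 'X^m : {poly int})`_d = hz (d%:Z - m%:Z).
Proof.
rewrite coefMXn /hz; case: ltnP => [dm|md].
  rewrite /binz; case E: (_ - 1) => [k|//].
  by rewrite bin_small //; lia.
rewrite coef_geomX; last by rewrite ltnS leq_subr.
have -> : d%:Z - m%:Z + n.+1%:Z - 1 = (d - m + n)%N%:Z by lia.
by [].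
Qed.

Lemma hz_le0 (z : int) : z <= 0 -> hz z = (z == 0)%:R.
Proof.
move=> z0; rewrite /hz; case: eqP => [->|/eqP zn].
  have -> : 0 + n.+1%:Z - 1 = n%:Z by lia.
  by rewrite /=; rewrite binn.
rewrite /binz; case E: (_ - 1) => [k|//].
by rewrite bin_small //; lia.
Qed.

Lemma a_coef_hz : a_coef l n.+1 la d = hz d%:Z - l%:Z * \sum_(x <- la) hz x%:Z
    + ((size la)%:Z - 1) * l%:Z
    + \sum_(2 <= k < l.+1) (-1) ^+ k * 'C(l, k)%:Z * hz (d%:Z - k%:Z * (d%:Z - d1%:Z))
    + 'C(l, 2)%:Z * hz (2 * d2%:Z - d%:Z)
    + l%:Z * (l%:Z - 1) * hz (d1%:Z + d2%:Z - d%:Z).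
Proof.
have -> : \sum_(x <- la) hz x%:Z = \sum_(x <- la) hz (d%:Z + x%:Z - d%:Z).
  by apply: eq_bigr => x _; rewrite addrAC subrr add0r.
have -> : 2 * d2%:Z - d%:Z = d%:Z + 2 * d2%:Z - 2 * d%:Z by ring.
have -> : d1%:Z + d2%:Z - d%:Z = d%:Z + d1%:Z + d2%:Z - 2 * d%:Z by ring.
by rewrite -[_ * l%:Z]mulr1 -[X in _ * l%:Z * X]/(1%N%:Z) -[1%N in X in _ * l%:Z * X](binn d).
Qed.

Lemma hz_d : hz d%:Z = ('C(d + n, n))%:Z.
Proof. by rewrite /hz (_ : d%:Z + n.+1%:Z - 1 = (d + n)%N%:Z) //; lia. Qed.

(** At [j = d] the arguments in [a_j] simplify, as [d - k (d - d1) = d1 - (k -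
    1) s] and [d + 2 d2 - 2 d = 2 d2 - d], and the formula for the dimension
    becomes the codimension count [N - 1 - a_d]. *)
Lemma predicted_dim_false :
  predicted_dim l n.+1 la = ambient_N n.+1 la - 1 \/
  predicted_dim l n.+1 la = ('C(d + n, n))%:Z - 1 - a_coef l n.+1 la d.
Proof.
rewrite {1 2}/predicted_dim; case: ifP => _; [by left|right].
rewrite a_coef_hz hz_d; set A := l%:Z * _.
have -> : A = l%:Z * (\sum_(x <- la) hz x%:Z - (size la)%:Z) by [].
have -> : \sum_(2 <= k < l.+1) (-1) ^+ k * 'C(l, k)%:Z * hz (d%:Z - k%:Z * (d%:Z - d1%:Z)) =
  \sum_(2 <= k < l.+1) (-1) ^+ k * 'C(l, k)%:Z *
    hz (d1%:Z - (k%:Z - 1) * (sumn (behead la))%:Z).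
  apply: eq_bigr => k _; congr (_ * hz _); rewrite /= PoszD.
  by move: (d2 + sumn t)%N => z; ring.
rewrite -[binz]/binz -!/(hz _) /=.
by ring.
Qed.

(** Binomial expansion of [(1 - P)^l]: the terms of exponent [0] and [1] give
    the first three terms of [a_d], and those of exponent [k >= 2] are
    evaluated with [partition_poly_pow]. *)
Lemma a_coefE : a_coef l n.+1 la d = (g ^+ n.+1 * (1 - partition_poly) ^+ l : {poly int})`_d.
Proof.
have coefW k : (2 <= k)%N -> (g ^+ n.+1 * partition_poly ^+ k : {poly int})`_d =
    hz (d%:Z - k%:Z * (d%:Z - d1%:Z)) + (((k == 2) * square_correction)%N)%:R.
  move=> k2; rewrite (congX_coef (congXM (congX_refl _ _) (partition_poly_pow k2)) (ltnSn _)).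
  rewrite mulrDr coefD coef_geom_Xn; congr (_ + _).
    by congr hz; rewrite PoszM subzn //= leq_addr.
  rewrite mulrCA -[_%:R](rmorph_nat polyC) coefCM coef_geom_Xn subrr hz_le0 //.
  by rewrite eqxx mulr1.
have coef1 : (g ^+ n.+1 * partition_poly : {poly int})`_d = \sum_(x <- la) hz x%:Z - ((size la)%:R - 1).
  rewrite /partition_poly mulrBr mulr_sumr coefB coef_sum; congr (_ - _).
    apply: eq_big_seq => x xla; rewrite coef_geom_Xn; congr hz.
    by have := leq_mem_sumn xla; lia.
  rewrite mulrCA -[1](rmorph1 polyC) -(rmorph_nat polyC) -rmorphB /= coefCM.
  by rewrite coef_geom_Xn subrr hz_le0 // eqxx mulr1.
rewrite exprDn mulr_sumr coef_sum -(big_mkord xpredT (fun k =>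
  (g ^+ n.+1 * (1 ^+ (l - k) * (- partition_poly) ^+ k *+ 'C(l, k)) : {poly int})`_d)).
rewrite (eq_bigr (fun k => (-1) ^+ k * ('C(l, k))%:Z * (g ^+ n.+1 * partition_poly ^+ k : {poly int})`_d)); last first.
  move=> k _; rewrite expr1n mul1r -mulr_natr.
  have -> : g ^+ n.+1 * ((- partition_poly) ^+ k * ('C(l, k))%:R) =
      ((-1) ^+ k * ('C(l, k))%:Z)%:P * (g ^+ n.+1 * partition_poly ^+ k).
    by rewrite [(- partition_poly) ^+ k]exprNn rmorphM rmorphXn rmorphN1 -natz rmorph_nat; ring.
  by rewrite coefCM.
rewrite big_ltn // big_ltn; last by lia.
rewrite !expr0 expr1 bin0 bin1 !mul1r mulr1 coef1.
rewrite (eq_big_nat _ _ (F2 := fun k => (-1) ^+ k * ('C(l, k))%:Z *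
   hz (d%:Z - k%:Z * (d%:Z - d1%:Z)) + ((-1) ^+ k * ('C(l, k))%:Z * ((k == 2) * square_correction)%N%:R))); last first.
  by move=> k /andP[k2 _]; rewrite coefW // mulrDr.
rewrite big_split /= [X in _ + (_ + (_ + X))]big_ltn; last by lia.
rewrite [X in _ + (_ + (_ + (_ + X)))]big1_seq ?addr0; last first.
  move=> k; rewrite mem_index_iota => /andP[_ /andP[k3 _]].
  by have -> : (k == 2)%N = false by [apply: gtn_eqF]; rewrite mul0n mulr0.
rewrite a_coef_hz -/d coef_geomX //.
have [d20 d21 _] := partition_bounds.
have -> : hz (2 * d2%:Z - d%:Z) = (2 * d2 == d)%N%:R.
  rewrite hz_le0; last by rewrite /=; lia.
  by congr (nat_of_bool _)%:R; apply/eqP/eqP; rewrite /=; lia.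
have -> : hz (d1%:Z + d2%:Z - d%:Z) = (d1 + d2 == d)%N%:R.
  rewrite hz_le0; last by rewrite /=; lia.
  by congr (nat_of_bool _)%:R; apply/eqP/eqP; rewrite /=; lia.
rewrite hz_d.
have -> : l%:Z * (l%:Z - 1) = 2 * ('C(l, 2))%:Z.
  have : ('C(l, 2) * 2 = l * l.-1)%N.
    by rewrite -[2%N in LHS]/(2`!) bin_ffact !ffactnS ffactn0 muln1.
  by move: l_ge2; move: 'C(l, 2) => c; case: (l) => // l' _; rewrite /=; nia.
have -> : ((2%N == 2%N) * square_correction)%:R =
    2 * (d1 + d2 == d)%N%:R + (2 * d2 == d)%N%:R :> int.
  by rewrite mul1n /square_correction natrD natrM.
rewrite -[(d1 + (d2 + sumn t))%N]/d -[(size t).+2]/(size la) !natz.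
by ring.
Qed.

End Prediction.

(** * The dimension of the secant variety *)

Lemma partition_gt0 (la : seq nat) :
  is_partition_of (sumn la) la -> (2 <= size la)%N -> (0 < sumn la)%N.
Proof.
case: la => [|d1 [|d2 t]] // laP _.
by have [] := partition_bounds laP; rewrite /=; lia.
Qed.

Lemma cofactor_numerator_partition (la : seq nat) (d := (\sum_(j < size la) nth 0 la j)%N) :
  cofactor_numerator (fun j : 'I_(size la) => nth 0%N la j) =
  \sum_(x <- la) 'X^(d - x) - ((size la)%:R - 1) * 'X^d.
Proof. by rewrite /cofactor_numerator (big_nth 0%N) big_mkord. Qed.

(** The lower bounds [count_some e] and [\sum_k count_first k] for the special
    tuple are inserted into [dim_tangent_leq]. As [\sum_k count_at k] is the
    positive part of the bound and each family with a marked pair has exactly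
    one first, the tangent space has dimension at most [count_some d -
    count_some e], which is [N] minus the difference of [count_none]. *)
Lemma tangent_dim_leq (K : fieldType) (charK : [pchar K] =i pred0) n l (la : seq nat)
    (d := (\sum_(j < size la) nth 0 la j)%N)
    (F : 'I_l -> 'I_(size la) -> {mpoly K[n.+1]}) :
  is_partition_of (sumn la) la -> (2 <= size la)%N -> (2 <= l)%N -> n.+2 = (2 * l)%N ->
  forms_of (fun j : 'I_(size la) => nth 0%N la j) F ->
  (\dim (ideal_part d (sum_gens F l)))%:Z + a_coef l n.+1 la d <= ('C(d + n, n))%:Z.
Proof.
move=> laP r2 l2 n_eq Fh.
have dE : sumn la = d by rewrite sumnE (big_nth 0%N) big_mkord.
set dd := fun j : 'I_(size la) => nth 0%N la j in Fh *.
have d0 : (0 < d)%N by rewrite -dE partition_gt0.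
have r0 : (0 < size la)%N by apply: leq_trans r2.
have [eps [epsP someP firstP]] :=
  exists_special_counts charK (dd := dd) n_eq d0.
have [e de] : exists e, d = e.+1 by exists d.-1; rewrite prednK.
have ed : (e <= d)%N by rewrite de.
have := dim_tangent_leq charK de Fh (special_homog dd n_eq) (special_neq0 dd n_eq).
have := sum_count_first (dd := dd) (l := l) eps.
have := count_some_none (dd := dd) (l := l) eps e.
have := count_some_none (dd := dd) (l := l) eps d.
have atE k := count_atE r0 epsP n_eq k.
have := count_none_diff r0 epsP n_eq de; rewrite cofactor_numerator_partition.
have -> : (geom d.+1 ^+ n.+1 * (1 - (\sum_(x <- la) 'X^(d - x) -
     ((size la)%:R - 1) * 'X^d)) ^+ l : {poly int})`_d = a_coef l n.+1 la d.
  rewrite -dE; case: (la) laP r2 => [|d1 [|d2 t]] // laP' _.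
  by rewrite a_coefE.
rewrite !(count_allE n_eq) //.
(* Pascal: the forms over [T] of degree [d] are those over [S] plus the
   multiples of the last variable. *)
have -> : 'C(d + n.+1, n.+1) = ('C(e + n.+1, n.+1) + 'C(d + n, n))%N.
  by rewrite [in LHS]de addSn binS addnS de addSn.
have sum_at : (\sum_k count_at (l := l) (dd := dd) eps k + l * (size la).-1 =
    l * \sum_(j < size la) 'C(nth 0 la j + n.+1, n.+1))%N.
  rewrite -[l in (l * (size la).-1)%N]card_ord -sum_nat_const -big_split /=.
  by rewrite (eq_bigr _ (fun k _ => atE k)) sum_nat_const card_ord.
have sum_first_leq : (\sum_k count_first (l := l) (dd := dd) eps k <=
    \sum_k \dim (ideal_part d (prod_gens (special (K := K) dd n_eq) k)))%N.
  by apply: leq_sum => k _; apply: firstP.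
have := someP e ed; rewrite -/(count_some eps e).
move: sum_at sum_first_leq.
set x1 := \dim _; set x2 := \dim _.
set y1 := (\sum_k count_at eps k)%N; set y2 := (\sum_k count_first eps k)%N.
set y3 := (\sum_k \dim _)%N; set z := (\sum_(j < size la) 'C(_, _))%N.
rewrite -/d -/(\sum_j dd j)%N.
move: (a_coef _ _ _ _) (l * z)%N (l * (size la).-1)%N 'C(e + n.+1, n.+1) 'C(d + n, n).
move: (count_some eps e) (count_some eps d) (count_none eps e) (count_none eps d).
by move: x1 x2 y1 y2 y3 => /= *; lia.
Qed.

Section Points.
Local Open Scope classical_set_scope.
Context {K : fieldType} {n : nat}.

Lemma proj_of_subproof (V : vectType K) (v : V) : v != 0 -> \dim <[v]>%VS == 1%N.
Proof. by rewrite dim_vline => ->. Qed.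

Definition proj_of (V : vectType K) (v : V) (v0 : v != 0) : proj V :=
  exist _ <[v]>%VS (proj_of_subproof v0).

(** The [d]-th powers of [l] variables are distinct reducible forms. *)
Lemma secant_nonempty l d (la : seq nat) : (2 <= size la)%N ->
  is_partition_of d la -> (l <= n.+1)%N -> (0 < l)%N ->
  [set P : proj (dhomog n.+1 K d) | exists p : 'I_l -> proj (dhomog n.+1 K d),
    [/\ injective p, forall i, reducible_forms K n.+1 d la (p i) &
        (line P <= \sum_(i < l) line (p i))%VS]] !=set0.
Proof.
move=> r2 laP ln l0; have dS : sumn la = d by case/and3P: (laP) => _ _ /eqP.
have d0 : (0 < d)%N by rewrite -dS partition_gt0 // dS.
pose x (i : 'I_l) : 'I_n.+1 := widen_ord ln i.
pose F i : dhomog n.+1 K d := hproj d ('X_(x i) ^+ d).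
have FE i : mpoly_of_dhomog (F i) = 'X_(x i) ^+ d.
  by apply: val_hproj; rewrite -[d in d.-homog]mul1n; apply/dhomogMn/homogX1.
have F0 i : F i != 0.
  apply: contraTneq isT => /(congr1 (@mpoly_of_dhomog _ _ _)).
  rewrite FE => /(congr1 (mcoeff (U_(x i) *+ d))).
  by rewrite mcoeffXn eqxx mcoeff0 => /eqP; rewrite oner_eq0.
have F_inj : injective (fun i => proj_of (F0 i)).
  move=> i j /(congr1 sval) /= Eij.
  have /vlineP[c Ec] : F i \in <[F j]>%VS by rewrite -Eij memv_line.
  apply/eqP; apply: contraTT isT => ij.
  have valZ : mpoly_of_dhomog (c *: F j) = c *: mpoly_of_dhomog (F j) by [].
  have /(congr1 (@mpoly_of_dhomog _ _ _)) := Ec; rewrite valZ !FE.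
  move/(congr1 (mcoeff (U_(x i) *+ d))); rewrite mcoeffZ !mcoeffXn eqxx.
  have -> : (U_(x j) *+ d == U_(x i) *+ d)%MM = false.
    apply/eqP => /(congr1 (fun m : 'X_{1..n.+1} => m (x j))).
    rewrite !mulmnE !mnm1E eqxx mul1n.
    have -> : (x i == x j) = false by rewrite -val_eqE /= val_eqE (negPf ij).
    by move=> E; move: d0; rewrite E mul0n.
  by move/eqP; rewrite mulr0 oner_eq0.
exists (proj_of (F0 (Ordinal l0))); exists (fun i => proj_of (F0 i)); split=> //.
  move=> i; pose Fi (j : 'I_(size la)) : dhomog n.+1 K (nth 0%N la j) :=
    hproj (nth 0%N la j) ('X_(x i) ^+ nth 0%N la j).
  have FiE j : mpoly_of_dhomog (Fi j) = 'X_(x i) ^+ nth 0%N la j.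
    by apply: val_hproj; rewrite -[X in X.-homog]mul1n; apply/dhomogMn/homogX1.
  exists (F i), Fi; split=> // [j|].
    apply: contraTneq isT => /(congr1 (@mpoly_of_dhomog _ _ _)).
    rewrite FiE => /(congr1 (mcoeff (U_(x i) *+ nth 0%N la j))).
    by rewrite mcoeffXn eqxx mcoeff0 => /eqP; rewrite oner_eq0.
  rewrite FE (eq_bigr _ (fun j _ => FiE j)) prodrXr; congr (_ ^+ _).
  by rewrite -dS sumnE (big_nth 0%N) big_mkord.
by rewrite (bigD1 (Ordinal l0)) //= addvSl.
Qed.

End Points.

(** A scalar multiple of a product is absorbed by the first factor. *)
Lemma reducible_vector (K : fieldType) n d (la : seq nat) (P : proj (dhomog n.+1 K d)) v :
  (0 < size la)%N -> reducible_forms K n.+1 d la P -> v \in line P ->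
  exists2 G : 'I_(size la) -> {mpoly K[n.+1]},
    forall j, G j \is (nth 0%N la j).-homog & mpoly_of_dhomog v = \prod_j G j.
Proof.
move=> r0 [F [Fi [_ FE ->]]] /vlineP[c ->].
exists (fun j => (if j == Ordinal r0 then c else 1) *: mpoly_of_dhomog (Fi j)).
  by move=> j; apply: dhomogZ; case: (Fi j).
rewrite linearZ /= FE (bigD1 (Ordinal r0)) //= [in RHS](bigD1 (Ordinal r0)) //= ?eqxx.
rewrite -scalerAl; congr (_ *: (_ * _)).
by apply: eq_bigr => j /negPf ->; rewrite scale1r.
Qed.

(** The secant variety is the closure of the image of [\sum_i \prod_j F i j],
    whose derivative takes values in the degree [d] part of the ideal of the
    cofactors. *)
Lemma secant_chain_leq (K : fieldType) (charK : [pchar K] =i pred0) n l (la : seq nat)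
    (dd := fun j : 'I_(size la) => nth 0%N la j) (d := (\sum_j dd j)%N) k :
  (0 < size la)%N -> (l < \dim {: dhomog n.+1 K d})%N ->
  has_irreducible_chain (secant_variety l (reducible_forms K n.+1 d la)) k ->
  exists2 F : 'I_l -> 'I_(size la) -> {mpoly K[n.+1]}, forms_of dd F &
    (k < \dim (ideal_part d (sum_gens F l)))%N.
Proof.
move=> r0 lN; rewrite /secant_variety leqNgt lN /= => chain.
have wP : polymap (fun v => \sum_i \prod_j gform (K := K) (l := l) (n := n.+1) (dd := dd) v i j) _ :=
  polymap_sum _ _ (fun i => polymap_prod xpredT (fun j => polymap_gform dd n.+1 i j)).
have [phi [phiE phi_rank]] := jacobian_rank_leq (polymap_linear (hproj d) wP).
have [|v kv] := chain_jacobian_rank charK (phi := phi) _ chain.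
  move=> f f0; apply: (vanishes_on_closure charK) => P v [p [_ pX Pp]] vP.
  have /memv_sumP[w wp ->] : v \in (\sum_(i < l) line (p i))%VS by apply: subvP vP.
  have [G Gh GE] := fin_all_exists2 (fun i => reducible_vector r0 (pX i) (wp i isT)).
  have [u uE] := gform_surj Gh.
  have -> : \sum_i w i = hproj d (\sum_i \prod_j gform (dd := dd) u i j).
    rewrite linear_sum; apply: eq_bigr => i _ /=.
    by rewrite (eq_bigr _ (fun j _ => uE i j)) -GE hprojK.
  rewrite -(meval_eq _ (phiE u)) -(meval_msubst phi f u) f0.
  exact: meval0.
exists (gform (dd := dd) v); first exact: gform_homog.
apply: leq_trans kv (phi_rank v _ _) => u.
rewrite linear_sum; apply: memv_suml => i _ /=.
rewrite linear_sum; apply: memv_suml => j _ /=; rewrite mulrC.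
have := mem_ideal_part d (sum_gens (gform (dd := dd) v) l) (i, j) (gform (dd := dd) u i j).
by rewrite /sum_gens ltn_ord.
Qed.

Theorem proposition5p17 (K : closedFieldType) (charK : [pchar K] =i pred0)
    (n l d : nat) (la : seq nat)
    (n_ge3 : (3 <= n)%N) (l_ge2 : (2 <= l)%N)
    (la_partition : is_partition_of d la) (r_ge2 : (2 <= size la)%N)
    (ln : (2 * l = n + 1)%N) :
  exists2 m : nat,
    is_proj_dim (secant_variety l (reducible_forms K n d la)) m
    & m%:Z <= predicted_dim l n la.
Proof.
case: n n_ge3 ln => // n n_ge2 ln; rewrite /=.
have laP : is_partition_of (sumn la) la.
  by case/and3P: (la_partition) => s0 s1 _; apply/and3P.
have dE : d = (\sum_(j < size la) nth 0 la j)%N.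
  by case/and3P: (la_partition) => _ _ /eqP <-; rewrite sumnE (big_nth 0%N) big_mkord.
have dS : sumn la = d by case/and3P: (la_partition) => _ _ /eqP.
have d0 : (0 < d)%N by rewrite -dS partition_gt0.
have n_eq : n.+2 = (2 * l)%N by rewrite ln addn1.
have dimV : \dim {: dhomog n.+1 K d} = 'C(d + n, n).
  by rewrite dimvf /= -bin_sub ?leq_addl // addnK.
(* With fewer points than dimensions the secant variety is the closure of the
   union of spans. *)
have lN : (l < \dim {: dhomog n.+1 K d})%N.
  rewrite dimV; apply: (@leq_trans 'C(n.+1, n)); first by rewrite binSn; lia.
  by apply: leq_bin2l; rewrite -add1n leq_add2r.
have r0 : (0 < size la)%N by apply: leq_trans r_ge2.
have chain_leq k : has_irreducible_chain (secant_variety l (reducible_forms K n.+1 d la)) k ->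
    (k < 'C(d + n, n))%N /\ k.+1%:Z + a_coef l n.+1 la d <= ('C(d + n, n))%:Z.
  subst d => chain.
  have [F Fh kF] := secant_chain_leq charK r0 lN chain.
  split.
    by rewrite -dimV; apply: leq_trans kF _; apply: dimvS; apply: subvf.
  apply: Order.POrderTheory.le_trans (tangent_dim_leq charK laP r_ge2 l_ge2 n_eq Fh).
  by rewrite lerD2r.
have nonempty : (secant_variety l (reducible_forms K n.+1 d la) !=set0)%classic.
  rewrite /secant_variety leqNgt lN /=.
  have [||P AP] := @secant_nonempty K n l d la r_ge2 la_partition.
  - by move: n_eq n_ge2; clear; lia.
  - by apply: leq_trans l_ge2.
  - by exists P => Z [_ AZ]; apply: AZ.
have [m mdim chain_m] := proj_dim_exists nonempty (fun k ck => ltnW (chain_leq k ck).1).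
exists m => //; have [mN ma] := chain_leq m chain_m.
have hE : binz (d%:Z + n.+1%:Z - 1) n = ('C(d + n, n))%:Z.
  by rewrite (_ : d%:Z + n.+1%:Z - 1 = (d + n)%N%:Z) //; lia.
have [E|E] : predicted_dim l n.+1 la = ambient_N n.+1 la - 1 \/
    predicted_dim l n.+1 la = ('C(d + n, n))%:Z - 1 - a_coef l n.+1 la d.
- by rewrite -dS; case: (la) r_ge2 laP => [|d1 [|d2 t]] // _ laP'; apply: predicted_dim_false.
- by rewrite E /ambient_N dS hE; move: mN; move: 'C(d + n, n) => c; lia.
by rewrite E; move: ma; move: (a_coef _ _ _ _) 'C(d + n, n) => a c; lia.
Qed.
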